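(* Let $\mathcal{H}$ be a Hilbert space, $T>0$, and let $C\subset\mathcal{H}$ be a nonempty ball-compact set. Let $F\colon[0,T]\times\mathcal{H}\rightrightarrows\mathcal{H}$ be a set-valued map with nonempty, closed and convex values such that: (H1) for all $t\in[0,T]$, $F(t,\cdot)$ is upper semicontinuous from $\mathcal{H}$ into $\mathcal{H}_w$; (H2) there is a Lipschitz continuous function $h\colon\mathcal{H}\to\mathbb{R}^+$ (with constant $L_h>0$) such that $\inf\{\|w\|:w\in F(t,x)\}\le h(x)$ for all $x\in\mathcal{H}$ and a.e. $t\in[0,T]$; (H3) there are $\gamma>0$ and a map $f\colon[0,T]\times\mathcal{H}\to\mathcal{H}$ such that $f(t,x)\in\operatorname{proj}^{\gamma}_{F(t,x)}(0)$ for all $(t,x)\in[0,T]\times\mathcal{H}$ and $f(\cdot,x)$ is measurable for all $x\in\mathcal{H}$. Then, for any $x_0\in C$, the sequence of functions $(x_n)_n$ generated by the catching-up algorithm with approximate projections for the fixed set $C$ (defined in the context) converges uniformly on $[0,T]$, up to a subsequence, to a Lipschitz solution $x$ of $$\dot{x}(t)\in -N(C;x(t))+F(t,x(t))\ \text{ for a.e. }t\in[0,T],\qquad x(0)=x_0,$$ such that $$\|\dot{x}(t)\|\le 2\big(h(x(t))+\sqrt{\gamma}\big)\quad\text{for a.e. }t\in[0,T].$$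
   Context: $\mathbb{B}$ is the closed unit ball of $\mathcal{H}$; $\mathcal{H}_w$ is $\mathcal{H}$ with the weak topology. For $S\subset\mathcal{H}$, $d_S(x)=\inf_{z\in S}\|x-z\|$. A set-valued map $G\colon\mathcal{H}\rightrightarrows\mathcal{H}$ is upper semicontinuous from $\mathcal{H}$ into $\mathcal{H}_w$ if $\{x: G(x)\cap D\neq\emptyset\}$ is closed for every weakly closed $D\subset\mathcal{H}$. A set $S$ is ball-compact if $S\cap r\mathbb{B}$ is compact for all $r>0$ (in particular such a set is closed). Approximate projections: for $\varepsilon>0$, $\operatorname{proj}^{\varepsilon}_S(x)=\{z\in S:\|x-z\|^2<d_S^2(x)+\varepsilon\}$. Clarke normal cone: for $x\in S$, the Clarke tangent cone $T(S;x)$ is the set of $v\in\mathcal{H}$ such that for every sequence $(x_n)$ in $S$ converging to $x$ and every sequence of positive numbers $(t_n)$ converging to $0$ there is $(v_n)$ converging to $v$ with $x_n+t_nv_n\in S$ for all $n$; $N(S;x)=\{w:\langle w,v\rangle\le0\ \forall v\in T(S;x)\}$ for $x\in S$, and $N(S;x)=\emptyset$ if $x\notin S$. Catching-up algorithm with approximate projections for the fixed set $C$: for $n\ge1$ let $\mu_n=T/n$ and $t_k^n=k\mu_n$ for $k=0,\dots,n$. Let $(\varepsilon_n)_n$ be a sequence of positive numbers with $\varepsilon_n/\mu_n^2\to0$. Let $f$ and $\gamma$ be as in (H3). Put $x_0^n=x_0$ and choose, for $k\in\{0,\dots,n-1\}$, any $$x_{k+1}^n\in\operatorname{proj}^{\varepsilon_n}_{C}\Big(x_k^n+\int_{t_k^n}^{t_{k+1}^n}f(s,x_k^n)\,ds\Big).$$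 Define $x_n(0)=x_0$ and, for $t\in\,]t_k^n,t_{k+1}^n]$, $$x_n(t)=x_k^n+\frac{t-t_k^n}{\mu_n}\Big(x_{k+1}^n-x_k^n-\int_{t_k^n}^{t_{k+1}^n}f(s,x_k^n)\,ds\Big)+\int_{t_k^n}^tf(s,x_k^n)\,ds.$$ Integrals are Bochner integrals, and measurability of $f(\cdot,x)$ is understood in the (strong) sense making them meaningful. *)

(* Defs.v *)
From HB Require Import structures.
From mathcomp Require Import all_boot all_order all_algebra.
From mathcomp Require Import all_classical all_reals all_analysis.

Set Implicit Arguments.
Unset Strict Implicit.
Unset Printing Implicit Defensive.

Import Order.TTheory GRing.Theory Num.Theory.
Import numFieldNormedType.Exports.

Local Open Scope classical_set_scope.
Local Open Scope ring_scope.

(* A real Hilbert space is given as [H : completeNormedModType R] together with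
   an inner product [dot : {dot H for idfun}] inducing the norm of [H]. *)
Definition induces_norm (R : realType) (H : completeNormedModType R)
    (dot : {dot H for idfun}) : Prop :=
  forall v : H, `|v| ^+ 2 = dot v v.

Section WeakTopology.
Context {R : realType} {H : completeNormedModType R}.

Definition cdual : Type := {l : {scalar H} | continuous (l : H -> R)}.

(* Coarsest topology on [H] making every element of the dual continuous. *)
Definition weak_topology : topologicalType :=
  sup_topology (fun l : cdual =>
    Topological.on (initial_topology (sval l : H -> R))).

Definition weakly_closed (D : set H) : Prop := closed (D : set weak_topology).

Definition usc_into_weak (G : H -> set H) : Prop :=
  forall D : set H, weakly_closed D -> closed [set x | G x `&` D !=set0].

End WeakTopology.

Section Sets.
Context {R : realType} {H : completeNormedModType R}.

Definition ball_compact (S : set H) : Prop :=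
  forall r : R, 0 < r -> compact (S `&` [set x | `|x| <= r]).

(* Meant for nonempty [S] only ([inf set0 = 0]). *)
Definition dist_to (S : set H) (x : H) : R := inf [set `|x - z| | z in S].

Definition approx_proj (e : R) (S : set H) (x : H) : set H :=
  [set z | S z /\ `|x - z| ^+ 2 < dist_to S x ^+ 2 + e].

Definition clarke_tangent (S : set H) (x : H) : set H :=
  [set v | forall (x_ : nat -> H) (t_ : nat -> R),
     (forall n, S (x_ n)) -> x_ n @[n --> \oo] --> x ->
     (forall n, 0 < t_ n) -> t_ n @[n --> \oo] --> 0 ->
     exists v_ : nat -> H,
       v_ n @[n --> \oo] --> v /\ forall n, S (x_ n + t_ n *: v_ n)].

Definition clarke_normal (dot : {dot H for idfun}) (S : set H) (x : H)
    : set H :=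
  [set w | S x /\ forall v, clarke_tangent S x v -> dot w v <= 0].

End Sets.

Section Bochner.
Context {R : realType} {H : completeNormedModType R}.

Let mu := @lebesgue_measure R.

Definition simple_fun (s : R -> H) : Prop :=
  finite_set (range s) /\
  forall v : H, measurable (s @^-1` [set v] : set (measurableTypeR R)).

Definition simple_int (a b : R) (s : R -> H) : H :=
  \sum_(v \in range s) (fine (mu (`[a, b] `&` s @^-1` [set v])) *: v).

Definition ae_limit_of_simple (a b : R) (s_ : nat -> R -> H) (g : R -> H)
    : Prop :=
  (forall n, simple_fun (s_ n)) /\
  {ae mu, forall t : R, t \in `[a, b] -> s_ n t @[n --> \oo] --> g t}.

(* Simple functions are Borel; as the limit is only almost everywhere, this is
   strong measurability with respect to the Lebesgue sigma-algebra. *)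
Definition strongly_measurable (a b : R) (g : R -> H) : Prop :=
  exists s_ : nat -> R -> H, ae_limit_of_simple a b s_ g.

(* The integrand [`|g - s_n|] need not be Borel, but it agrees almost
   everywhere with a nonnegative Borel function, so that the library's integral
   (a supremum over simple functions below it) is its Lebesgue integral. *)
Definition is_bochner_int (a b : R) (g : R -> H) (I : H) : Prop :=
  exists s_ : nat -> R -> H,
    [/\ ae_limit_of_simple a b s_ g,
        (\int[mu]_(t in `[a, b]) `|g t - s_ n t|%:E)%E @[n --> \oo] --> 0%E &
        simple_int a b (s_ n) @[n --> \oo] --> I].

Definition bochner_int (a b : R) (g : R -> H) : H :=
  xget 0 [set I | is_bochner_int a b g I].

End Bochner.

Section CatchingUp.
Context {R : realType} {H : completeNormedModType R}.

Definition step (T : R) (n : nat) : R := T / n%:R.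

Definition node (T : R) (n k : nat) : R := k%:R * step T n.

Definition catching_up_nodes (C : set H) (f : R -> H -> H) (T : R) (x0 : H)
    (n : nat) (e : R) (y : nat -> H) : Prop :=
  y 0%N = x0 /\
  forall k, (k < n)%N ->
    approx_proj e C
      (y k + bochner_int (node T n k) (node T n k.+1) (fun s => f s (y k)))
      (y k.+1).

Definition catching_up_interpolant (f : R -> H -> H) (T : R) (x0 : H)
    (n : nat) (y : nat -> H) (u : R -> H) : Prop :=
  u 0 = x0 /\
  forall k t, (k < n)%N -> node T n k < t <= node T n k.+1 ->
    u t = y k
      + ((t - node T n k) / step T n) *:
          (y k.+1 - y k
           - bochner_int (node T n k) (node T n k.+1) (fun s => f s (y k)))
      + bochner_int (node T n k) t (fun s => f s (y k)).

(* The functions [u n] are only constrained for [1 <= n] and on [[0, T]]. *)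
Definition catching_up (C : set H) (f : R -> H -> H) (T : R) (x0 : H)
    (eps : nat -> R) (u : nat -> R -> H) : Prop :=
  forall n, (0 < n)%N ->
    exists y : nat -> H,
      catching_up_nodes C f T x0 n (eps n) y /\
      catching_up_interpolant f T x0 n y (u n).

End CatchingUp.

(* Main.v *)
Require Import Defs.
From HB Require Import structures.
From mathcomp Require Import all_boot all_order all_algebra finmap.
From mathcomp Require Import all_classical all_reals all_analysis.
From mathcomp Require Import measurable_realfun ring lra.

Set Implicit Arguments.
Unset Strict Implicit.
Unset Printing Implicit Defensive.

Import Order.TTheory GRing.Theory Num.Theory.
Import numFieldNormedType.Exports.
Import HBNNSimple.

Local Open Scope classical_set_scope.
Local Open Scope ring_scope.

(* Write the interpolant as [x_n(t) = x0 + int_0^t (P_n - V_n)], where on each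
   cell [P_n] is [f(., x_k^n)] and [V_n] is the residual of the approximate
   projection divided by [mu_n]. A discrete Gronwall inequality bounds all these
   functions uniformly, and the limit of the interpolants along an ultrafilter
   is uniform along a subsequence.

   Weak compactness in [L^2] is replaced by the parallelogram law: almost norm
   minimizing midpoint combinations of the tails of [(V_n, P_n)] are Cauchy in
   [L^2] at a geometric rate, hence converge almost everywhere to some [(V, P)].
   Then [x] is a primitive of [P - V], and Lebesgue points of the functions
   [|P - V - d|], [d] in a countable set, give [x' = P - V] almost everywhere.

   [P(t)] lies in [F(t, x(t))]: otherwise a half-space separates them, and (H1)
   applied to this half-space gives a contradiction. For [V(t)] it is enough that
   [limsup <V_n(t), v> <= 0] for every Clarke tangent vector [v], which follows
   by comparing the approximate projection with the points of [C] provided by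
   the sequential definition of the tangent cone for the step sizes
   [mu_n sqrt(eps_n / mu_n^2)]. *)

(** * Hilbert space geometry *)

(** The velocities are treated as a pair because the same midpoint combinations must act on both
    components: only then do the combined differences [P_n - V_n] still integrate to [x] in the
    limit. What is wanted of the limits at a fixed time (normality, membership in [F], norm bounds)
    is phrased through inequalities [dot e _ <= c] valid for all large indices. These survive
    midpoints of tails and limits, whatever the weights.

    The factor 2 in the speed bound comes from the two components: (H2) and (H3) bound [P_n] by
    [h + sqrt gamma] at the current node, and that node competes in the projection, so [V_n] obeys
    the same bound up to [sqrt eps_n / mu_n]. Thus [eps_n / mu_n^2 -> 0] serves twice, here and in
    the tangent test.

    The space may be nonseparable and (H2) bounds [f(., p)] only almost everywhere. Measurability is
    therefore handled through countable approximating families, and each [f(., p)] is replaced by a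
    Borel representative bounded everywhere; only countably many nodes [p] occur, so one null set
    covers them all. *)

Section Hilbert.
Context {R : realType} {H : completeNormedModType R}.
Variable dot : {dot H for idfun}.
Hypothesis dotE : induces_norm dot.
Implicit Types u v e : H.

Lemma dotC u v : dot u v = dot v u.
Proof. by rewrite (@hermC _ _ _ _ dot u v) /= expr0 mul1r. Qed.

Lemma dotDr e u v : dot e (u + v) = dot e u + dot e v.
Proof. exact: linearD. Qed.

Lemma dotZr a e u : dot e (a *: u) = a * dot e u.
Proof. by rewrite linearZ. Qed.

Lemma dotNr e u : dot e (- u) = - dot e u.
Proof. exact: linearN. Qed.

Lemma dotBr e u v : dot e (u - v) = dot e u - dot e v.
Proof. exact: linearB. Qed.

Lemma dot0r e : dot e 0 = 0.
Proof. exact: linear0. Qed.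

Lemma dotDl u v e : dot (u + v) e = dot u e + dot v e.
Proof. by rewrite dotC dotDr !(dotC e). Qed.

Lemma dotZl a u e : dot (a *: u) e = a * dot u e.
Proof. by rewrite dotC dotZr (dotC e). Qed.

Lemma dotNl u e : dot (- u) e = - dot u e.
Proof. by rewrite dotC dotNr (dotC e). Qed.

Lemma dot_sumr (I : Type) (r : seq I) (e : H) (F : I -> H) :
  dot e (\sum_(i <- r) F i) = \sum_(i <- r) dot e (F i).
Proof. exact: linear_sum. Qed.

Lemma sqr_normD u v : `|u + v| ^+ 2 = `|u| ^+ 2 + 2 * dot u v + `|v| ^+ 2.
Proof. by rewrite !dotE dotDl !dotDr (dotC v u); ring. Qed.

Lemma sqr_normB u v : `|u - v| ^+ 2 = `|u| ^+ 2 - 2 * dot u v + `|v| ^+ 2.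
Proof. by rewrite sqr_normD dotNr normrN; ring. Qed.

Lemma parallelogram u v :
  `|2^-1 *: (u + v)| ^+ 2 + `|u - v| ^+ 2 / 4 = (`|u| ^+ 2 + `|v| ^+ 2) / 2.
Proof.
rewrite normrZ exprMn (@ger0_norm _ 2^-1)//.
by rewrite sqr_normB sqr_normD; field.
Qed.

Lemma dot_le u v : dot u v <= `|u| * `|v|.
Proof.
have [->|u0] := eqVneq u 0; first by rewrite dotC dot0r normr0 mul0r.
have [->|v0] := eqVneq v 0; first by rewrite dot0r normr0 mulr0.
have pu : 0 < `|u| by rewrite normr_gt0.
have pv : 0 < `|v| by rewrite normr_gt0.
have := sqr_ge0 `| `|v| *: u - `|u| *: v|.
rewrite sqr_normB dotZl dotZr !normrZ !normr_id => k.
have {k} : 0 <= 2 * (`|u| * `|v|) * (`|u| * `|v| - dot u v) by lra.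
by rewrite pmulr_rge0 ?subr_ge0// !mulr_gt0.
Qed.

Lemma norm_dot_le u v : `|dot u v| <= `|u| * `|v|.
Proof.
by rewrite ler_norml dot_le andbT lerNl -dotNr (le_trans (dot_le _ _))// normrN.
Qed.

Lemma norm_le_dot c v : 0 <= c -> (forall e, dot e v <= c * `|e|) -> `|v| <= c.
Proof.
move=> c0 h; have [->|v0] := eqVneq v 0; first by rewrite normr0.
have := h v; rewrite -dotE expr2 ler_pM2r// normr_gt0//.
Qed.

Lemma cvg_dot (T : Type) (F : set_system T) {FF : Filter F} (e v : H)
    (f : T -> H) : f @ F --> v -> (dot e (f x) @[x --> F]) --> dot e v.
Proof.
move=> fv; apply/cvgrPdist_le => d d0.
have e1 : 0 < `|e| + 1 by rewrite ltr_wpDl.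
have /cvgrPdist_le/(_ (d / (`|e| + 1)))/(_ _)  := fv.
rewrite divr_gt0// => /(_ isT); apply: filterS => x xd.
rewrite -dotBr (le_trans (norm_dot_le _ _))//.
rewrite (@le_trans _ _ ((`|e| + 1) * `|v - f x|))//.
  by rewrite ler_wpM2r// lerDl.
by rewrite mulrC -ler_pdivlMr.
Qed.

Lemma dot_continuous e : continuous (dot e : H -> R).
Proof. by move=> x; apply: cvg_dot. Qed.

End Hilbert.

(* The infima of [J] over the [S n] increase to a limit [s]; two near-minimizers
   with values close to [s] are close to each other, because [J] of their midpoint
   is almost at least [s]. *)
Lemma midpoint_minimizing (R : realType) (V : lmodType R) (S : nat -> set V)
    (J Q : V -> R) (B : R) (delta : nat -> R) :
  (forall n, 0 < delta n) -> {homo delta : m n / (m <= n)%N >-> n <= m} ->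
  (forall n, S n !=set0) -> {homo S : m n / (m <= n)%N >-> n `<=` m} ->
  (forall n u v, S n u -> S n v -> S n (2^-1 *: (u + v))) ->
  (forall u, S 0%N u -> 0 <= J u <= B) ->
  (forall u v, S 0%N u -> S 0%N v ->
     J (2^-1 *: (u + v)) + Q (u - v) / 4 = (J u + J v) / 2) ->
  exists w : nat -> V, (forall n, S n (w n)) /\
    (forall n, Q (w n - w n.+1) <= delta n) /\
    (forall n u, (forall m, S m u) -> J (w n) <= J u + delta n).
Proof.
move=> d_gt0 d_dec S_neq0 S_dec S_mid J_bd J_par.
have SS0 n : S n `<=` S 0%N by exact: S_dec.
pose d n := inf (J @` S n).
have J_inf n : has_inf (J @` S n).
  split; first by have [u Su] := S_neq0 n; exists (J u); exists u.
  by exists 0 => _ [u /SS0/J_bd/andP[? ?] <-].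
have d_le n u : S n u -> d n <= J u.
  by move=> Su; apply: ge_inf; [exact: (J_inf n).2|exists u].
have d_ndec : {homo d : m n / (m <= n)%N >-> m <= n}.
  move=> m n mn; apply: lb_le_inf; first exact: (J_inf n).1.
  by move=> _ [u /(S_dec _ _ mn) Su <-]; exact: d_le.
pose s := sup (range d).
have d_sup : has_sup (range d).
  split; first by exists (d 0%N); exists 0%N.
  exists B => _ [n _ <-]; have [u Su] := S_neq0 n.
  by rewrite (le_trans (d_le _ _ Su))//; have /andP[] := J_bd _ (SS0 _ _ Su).
have d_s n : d n <= s by apply: ub_le_sup; [exact: d_sup.2|exists n].
(* With an error [delta n / 16] on each side, the value at a midpoint falls short of the mean of the
   two values by at most [delta n / 8], so [Q <= delta n / 2]. The witness for [N] lies beyond both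
   [n] and the index where the infima come close to [s]. *)
have /choice[w /= wP] : forall n, exists u, exists N,
    [/\ (n <= N)%N, s - delta n / 16 <= d N, S N u & J u <= s + delta n / 16].
  move=> n; have e0 : 0 < delta n / 16 by rewrite divr_gt0.
  have [_ [N _ <-] sN] := sup_adherent e0 d_sup.
  pose K := maxn n N.
  have [_ [u Su <-] uK] := inf_adherent e0 (J_inf K).
  exists u, K; split => //; first exact: leq_maxl.
    by rewrite (le_trans (ltW sN))// d_ndec// leq_maxr.
  by rewrite (le_trans (ltW uK))// lerD2r d_s.
exists w; split => [n|]; last split => [n|n u Su].
- by have [N [nN _ + _]] := wP n; exact: S_dec.
- have [N [nN sN wN JN]] := wP n; have [N' [nN' sN' wN' JN']] := wP n.+1.
  pose K := minn N N'.
  have sK : s - delta n / 16 <= d K.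
    rewrite /K /minn; case: ifP => // _; apply: le_trans sN'.
    by have := d_dec _ _ (leqnSn n); lra.
  have wK : S K (w n) by apply: S_dec wN; exact: geq_minl.
  have wK' : S K (w n.+1) by apply: S_dec wN'; exact: geq_minr.
  have := J_par _ _ (SS0 _ _ wK) (SS0 _ _ wK').
  have := d_le _ _ (S_mid _ _ _ wK wK').
  by have := d_dec _ _ (leqnSn n); have := d_gt0 n; lra.
- have [N [nN sN wN JN]] := wP n; have := d_gt0 n.
  have : s <= J u.
    by apply: ge_sup; [exact: d_sup.1|move=> _ [m _ <-]; exact: d_le].
  lra.
Qed.

(** * Closest points and separation from closed convex sets *)

Section Separation.
Context {R : realType} {H : completeNormedModType R}.
Variable dot : {dot H for idfun}.
Hypothesis dotE : induces_norm dot.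
Implicit Types u v e : H.

Lemma cvgn_of_summable_steps (w : nat -> H) :
  cvgn (series (fun n => `|w n - w n.+1|)) -> cvgn w.
Proof.
move=> /normed_cvg cw.
have -> : w = (fun n => w 0%N - series (fun n => w n - w n.+1) n).
  apply/funext => n; rewrite seriesEnat/= -[X in _ - X]opprK -sumrN.
  under eq_bigr do rewrite opprB.
  by rewrite telescope_sumr// opprK addrC subrK.
exact: is_cvgB (is_cvg_cst _) cw.
Qed.

Lemma cvgn_of_geometric_steps (w : nat -> H) (c : R) :
  (forall n, `|w n - w n.+1| <= c * 2^-1 ^+ n) -> cvgn w.
Proof.
move=> wc; apply: cvgn_of_summable_steps.
apply: (@series_le_cvg _ _ (geometric c 2^-1)) => //=.
  by move=> n; exact: le_trans (normr_ge0 _) (wc n).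
by apply: is_cvg_geometric_series; rewrite ger0_norm//; lra.
Qed.

Lemma convex_comb (A : set H) (x y : H) (l : R) :
  convex_set A -> 0 <= l <= 1 -> A x -> A y -> A (l *: x + (1 - l) *: y).
Proof.
move=> Acv /andP[l0 l1] Ax Ay.
have l01 : 0 <= l <= 1 by rewrite l0 l1.
have := Acv x y (Itv01 l0 l1) (mem_set Ax) (mem_set Ay).
by rewrite inE.
Qed.

(** The constant sequence with value [A] cut by a sublevel set of [J] is fed to
    [midpoint_minimizing]; the cut supplies the upper bound on [J]. The tolerance [4^-1 ^+ n] on
    squared distances makes the steps at most [2^-1 ^+ n], and a point of [A] outside the sublevel
    set is farther from [p] than [a0]. *)
Lemma closest_point (A : set H) (p : H) :
  A !=set0 -> closed A -> convex_set A ->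
  exists2 q, A q & forall a, A a -> `|q - p| <= `|a - p|.
Proof.
move=> [a0 Aa0] Acl Acv.
pose J u : R := `|u - p| ^+ 2.
pose S := fun _ : nat => A `&` [set u | J u <= J a0].
have mid u v : 2^-1 *: (u + v) - p = 2^-1 *: ((u - p) + (v - p)).
  by rewrite addrACA -opprD scalerBr -[p + p]mulr2n -(scaler_nat 2 p) scalerA mulVf//
    scale1r.
have Jmid u v : J (2^-1 *: (u + v)) + `|u - v| ^+ 2 / 4 = (J u + J v) / 2.
  rewrite /J mid -(parallelogram dotE); congr (_ + `|_| ^+ 2 / _).
  by rewrite opprB addrA subrK.
have d0 n : 0 < 4^-1 ^+ n :> R by rewrite exprn_gt0.
have [|||||w [Sw [Qw Jw]]] := @midpoint_minimizing _ H S J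
  (fun u => `|u| ^+ 2) (J a0) (fun n => 4^-1 ^+ n) d0 _ _ _ _ _ (fun u v _ _ => Jmid u v).
- by move=> m n mn; apply: ler_wiXn2l => //; lra.
- by move=> n; exists a0; split => /=.
- by move=> m n _ u.
- move=> n u v [Au Ju] [Av Jv]; split.
    rewrite scalerDr {2}(_ : 2^-1 = 1 - 2^-1); last by lra.
    by apply: convex_comb => //; apply/andP; split; lra.
  by rewrite /=; have := Jmid u v; have := sqr_ge0 `|u - v|; move: Ju Jv => /=; lra.
- by move=> u [_ Ju]; rewrite sqr_ge0.
have cw : cvgn w.
  apply: (@cvgn_of_geometric_steps _ 1) => n; rewrite mul1r.
  rewrite -(@ler_pXn2r _ 2)// ?nnegrE// ?exprn_ge0//.
  by rewrite (le_trans (Qw n))// -exprM mulnC exprM expr2 -invfM -natrM.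
exists (limn w).
  by apply: (closed_cvg A Acl _ _ cw); apply: nearW => n; have [] := Sw n.
move=> a Aa; rewrite -(@ler_pXn2r _ 2)// ?nnegrE//.
have lim0 : J (w n) @[n --> \oo] --> J (limn w).
  apply: cvgM; apply: cvg_norm; apply: cvgB => //; exact: cvg_cst.
have [|aa0] := leP (J a) (J a0) => [Ja|]; last first.
  apply: le_trans (ltW aa0); apply: (cvgr_to_le lim0).
  by apply: nearW => n; have [] := Sw n.
rewrite -/(J _) -/(J a).
have lim1 : J a + 4^-1 ^+ n @[n --> \oo] --> J a.
  rewrite -[X in _ --> X]addr0; apply: cvgD; first exact: cvg_cst.
  by apply: cvg_expr; rewrite ger0_norm//; lra.
by apply: ler_cvg_to lim0 lim1 _; apply: nearW => n; apply: Jw => m; split.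
Qed.

(** The normal is [p - q] with [q] the closest point: moving from [q] towards a point of [A] cannot
    decrease the distance to [p]. The level [c] is halfway between the values of the functional at
    [q] and at [p], which makes both inequalities strict. *)
Lemma separation (A : set H) (p : H) :
  A !=set0 -> closed A -> convex_set A -> ~ A p ->
  exists (e : H) (c : R), (forall a, A a -> dot e a < c) /\ c < dot e p.
Proof.
move=> A0 Acl Acv Ap.
have [q Aq qmin] := closest_point p A0 Acl Acv.
have pq : 0 < `|p - q| by rewrite normr_gt0 subr_eq0; apply/eqP => pq; rewrite pq in Ap.
have pq2 : 0 < `|p - q| ^+ 2 by rewrite exprn_gt0.
have var a : A a -> dot (p - q) (a - q) <= 0.
  move=> Aa; rewrite leNgt; apply/negP; set b := dot _ _ => b0.
  set K := `|a - q| ^+ 2.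
  have K0 : 0 <= K by rewrite sqr_ge0.
  (* Minimality of [q] against [l *: a + (1 - l) *: q] yields [2 * b <= l * K], while this [l] lies
     in [[0, 1]] and has [l * K <= b]. *)
  pose l := b / (b + K).
  have bK : 0 < b + K by lra.
  have l01 : 0 <= l <= 1.
    by rewrite divr_ge0 ?(ltW b0) ?(ltW bK)//= ler_pdivrMr// mul1r lerDl.
  have l0 : 0 < l by rewrite divr_gt0.
  have := qmin _ (convex_comb Acv l01 Aa Aq).
  rewrite -(@ler_pXn2r _ 2)// ?nnegrE// distrC.
  have -> : l *: a + (1 - l) *: q - p = - ((p - q) - l *: (a - q)).
    by rewrite opprB opprB scalerBr scalerBl scale1r (addrC q) !addrA.
  rewrite normrN (sqr_normB dotE (p - q)) (dotZr dot) normrZ exprMn (ger0_norm (ltW l0)) -/b -/K => k.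
  have {k} : 2 * (l * b) <= l ^+ 2 * K by lra.
  rewrite expr2 -mulrA mulrCA ler_pM2l// leNgt => /negP; apply.
  apply: (@le_lt_trans _ _ b); last by lra.
  rewrite /l mulrAC ler_pdivrMr// ler_pM2l//; lra.
exists (p - q), (dot (p - q) q + `|p - q| ^+ 2 / 2); split.
  by move=> a /var; rewrite (dotBr dot (p - q) a q) => ?; lra.
have -> : dot (p - q) p = dot (p - q) q + `|p - q| ^+ 2.
  by rewrite dotE (dotBr dot (p - q) p q); ring.
lra.
Qed.

End Separation.

(** * Strong measurability and Bochner integrals *)

#[local] Instance lebesgue_ae_filter (R : realType) :
  Filter (nbhs (almost_everywhere (@lebesgue_measure R))).
Proof. exact: (ae_filter_ringOfSetsType (@lebesgue_measure R)). Qed.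

Lemma lebesgue_ae_neq (R : realType) (a : R) :
  {ae @lebesgue_measure R, forall t, t != a}.
Proof.
exists [set a]; split; rewrite ?lebesgue_measure_set1//.
by move=> t /= /negP; rewrite negbK => /eqP.
Qed.

(** * Bounded Borel functions and their integrals over compact intervals *)

Section BoundedMeasurable.
Context {R : realType}.
Implicit Types (a b c M : R) (k : R -> R).
Local Notation mu := (@lebesgue_measure R).

(** Both conditions are imposed on the whole line, so that the class is stable under the operations
    used and each member is integrable on every compact interval. *)
Definition bmeas k := measurable_fun setT k /\ exists M, forall t, `|k t| <= M.

Definition rint a b k : R := \int[mu]_(t in `[a, b]) k t.

Lemma lebesgue_measure_itvcc a b : a <= b -> mu `[a, b]%classic = (b - a)%:E.
Proof.
move=> ab; rewrite lebesgue_measure_itv/= lte_fin; case: ltP => // ba.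
by rewrite (_ : b = a) ?subrr//; apply/eqP; rewrite eq_le ba ab.
Qed.

Lemma lebesgue_measure_itvcc_lty a b : (mu `[a, b]%classic < +oo)%E.
Proof. by rewrite lebesgue_measure_itv/=; case: ifP; rewrite ?ltry. Qed.

Lemma bmeas_integrable a b k : bmeas k -> mu.-integrable `[a, b] (EFin \o k).
Proof.
move=> [mk [M kM]]; apply: measurable_bounded_integrable.
- exact: measurable_itv.
- exact: lebesgue_measure_itvcc_lty.
- exact: measurable_funS mk.
- exists M; split; first exact: num_real.
  by move=> x Mx t _ /=; rewrite (le_trans (kM t))// ltW.
Qed.

Lemma bmeas_cst c : bmeas (fun=> c).
Proof. by split; [exact: measurable_cst|exists `|c|]. Qed.

Lemma bmeasD k l : bmeas k -> bmeas l -> bmeas (fun t => k t + l t).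
Proof.
move=> [mk [M kM]] [ml [N lN]]; split; first exact: measurable_funD.
by exists (M + N) => t; rewrite (le_trans (ler_normD _ _))// lerD.
Qed.

Lemma bmeasM k l : bmeas k -> bmeas l -> bmeas (fun t => k t * l t).
Proof.
move=> [mk [M kM]] [ml [N lN]]; split; first exact: measurable_funM.
by exists (M * N) => t; rewrite normrM ler_pM.
Qed.

Lemma bmeasZ c k : bmeas k -> bmeas (fun t => c * k t).
Proof. exact/bmeasM/bmeas_cst. Qed.

Lemma bmeasN k : bmeas k -> bmeas (fun t => - k t).
Proof.
move=> /(bmeasZ (-1)); rewrite (_ : (fun _ => _) = (fun t => - k t))//.
by apply/funext => t; rewrite mulN1r.
Qed.

Lemma bmeasB k l : bmeas k -> bmeas l -> bmeas (fun t => k t - l t).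
Proof. by move=> mk /bmeasN; exact: bmeasD. Qed.

Lemma bmeas_norm k : bmeas k -> bmeas (fun t => `|k t|).
Proof.
move=> [mk [M kM]]; split; first exact: measurableT_comp.
by exists M => t; rewrite normr_id.
Qed.

Lemma rintD a b k l : bmeas k -> bmeas l ->
  rint a b (fun t => k t + l t) = rint a b k + rint a b l.
Proof. by move=> mk ml; apply: RintegralD => //; exact: bmeas_integrable. Qed.

Lemma rintZ a b c k : bmeas k -> rint a b (fun t => c * k t) = c * rint a b k.
Proof. by move=> mk; apply: RintegralZl => //; exact: bmeas_integrable. Qed.

Lemma rintB a b k l : bmeas k -> bmeas l ->
  rint a b (fun t => k t - l t) = rint a b k - rint a b l.
Proof. by move=> mk ml; apply: RintegralB => //; exact: bmeas_integrable. Qed.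

Lemma rint_cst a b c : a <= b -> rint a b (fun=> c) = (b - a) * c.
Proof.
by move=> ab; rewrite /rint Rintegral_cst//= lebesgue_measure_itvcc//= mulrC.
Qed.

Lemma rint_le a b k l : bmeas k -> bmeas l ->
  (forall t, a <= t <= b -> k t <= l t) -> rint a b k <= rint a b l.
Proof.
by move=> mk ml kl; apply: le_Rintegral => //; exact: bmeas_integrable.
Qed.

Lemma rint_ge0 a b k : (forall t, 0 <= k t) -> 0 <= rint a b k.
Proof. by move=> k0; apply: Rintegral_ge0. Qed.

Lemma rint_norm_le a b k : bmeas k -> `|rint a b k| <= rint a b (fun t => `|k t|).
Proof. by move=> mk; apply: le_normr_Rintegral => //; exact: bmeas_integrable. Qed.

Lemma rint_split a b c k : bmeas k -> a <= c <= b ->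
  rint a b k = rint a c k + rint c b k.
Proof.
move=> mk /andP[ac cb]; have /= ik := bmeas_integrable a b mk.
rewrite /rint -[X in _ + X]Rintegral_itv_obnd_cbnd; last first.
  apply: integrableS ik => //; apply: subset_itvr; rewrite bnd_simp//.
by rewrite -(Rintegral_itvB ik) ?bnd_simp// addrC subrK.
Qed.

Lemma rint_point a k : rint a a k = 0.
Proof. by rewrite /rint set_itv1 Rintegral_set1. Qed.

Lemma ae_eq_rint a b k l : bmeas k -> bmeas l ->
  {ae mu, forall t, a <= t <= b -> k t = l t} -> rint a b k = rint a b l.
Proof.
move=> [mk _] [ml _] kl; rewrite /rint /Rintegral; congr fine.
apply: ae_eq_integral => //.
- by apply/measurable_EFinP; exact: measurable_funS mk.
- by apply/measurable_EFinP; exact: measurable_funS ml.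
- by apply: filterS kl => t klt /=; rewrite in_itv/= => /klt ->.
Qed.

Lemma rint_EFin a b k : bmeas k ->
  (\int[mu]_(t in `[a, b]) (k t)%:E)%E = (rint a b k)%:E.
Proof.
move=> mk; rewrite /rint /Rintegral fineK//.
by apply: integrable_fin_num => //; exact: bmeas_integrable.
Qed.

Lemma rint_cvg a b M (k_ : nat -> R -> R) k :
  (forall n, bmeas (k_ n)) -> (forall n t, `|k_ n t| <= M) -> bmeas k ->
  {ae mu, forall t, a <= t <= b -> k_ n t @[n --> \oo] --> k t} ->
  rint a b (k_ n) @[n --> \oo] --> rint a b k.
Proof.
move=> mk_ k_M mk k_k.
have := @dominated_convergence _ _ R mu `[a, b]%classic
  (measurable_itv _) (fun n => EFin \o k_ n) (EFin \o k) (fun=> M%:E)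
  (fun n => @measurable_int _ _ _ mu _ _ (bmeas_integrable a b (mk_ n)))
  (@measurable_int _ _ _ mu _ _ (bmeas_integrable a b mk)) _
  (bmeas_integrable a b (bmeas_cst M)) _.
case.
- apply: filterS k_k => t k_k; rewrite /= in_itv/= => /k_k {}k_k.
  exact: cvg_comp k_k _.
- by apply: aeW => t n _; rewrite lee_fin.
by move=> _ _; rewrite /= (rint_EFin a b mk) => /fine_cvg.
Qed.

End BoundedMeasurable.

(** * Strong measurability through pairings and separable range *)

Section PettisMeasurable.
Context {R : realType} {H : completeNormedModType R}.
Variable dot : {dot H for idfun}.
Hypothesis dotE : induces_norm dot.
Implicit Types (g : R -> H) (u v e : H).
Local Notation mu := (@lebesgue_measure R).

(** Any [countType] may index the family: pairs, options and sigma types then serve directly for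
    sums, products with indicators and limits. The [D i] need not be values of [g]. *)
Definition separably_valued g := exists (I : countType) (D : I -> H),
  forall t r, 0 < r -> exists i, `|g t - D i| < r.

(* Pettis' description of strong measurability, with Borel sets. *)
Definition pmeas g :=
  (forall e, measurable_fun setT (fun t => dot e (g t))) /\ separably_valued g.

Lemma pmeas_cst v : pmeas (fun=> v).
Proof.
split => [e|]; first exact: measurable_cst.
by exists unit, (fun=> v) => t r r0; exists tt; rewrite subrr normr0.
Qed.

Lemma pmeasD g g' : pmeas g -> pmeas g' -> pmeas (fun t => g t + g' t).
Proof.
move=> [mg [I [D gD]]] [mg' [I' [D' gD']]]; split => [e|].
  under eq_fun do rewrite dotDr; exact: measurable_funD.
exists (I * I')%type, (fun i => D i.1 + D' i.2) => t r r0.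
have r2 : 0 < r / 2 by rewrite divr_gt0.
have [i di] := gD t _ r2; have [j dj] := gD' t _ r2.
exists (i, j); rewrite /= opprD addrACA (le_lt_trans (ler_normD _ _))//.
by rewrite (splitr r) ltrD.
Qed.

Lemma pmeasZ c g : pmeas g -> pmeas (fun t => c *: g t).
Proof.
move=> [mg [I [D gD]]]; split => [e|].
  under eq_fun do rewrite dotZr.
  by apply: measurable_funM => //; exact: measurable_cst.
exists I, (fun i => c *: D i) => t r r0.
have c0 : 0 < `|c| + 1 by rewrite ltr_wpDl.
have [i di] := gD t _ (divr_gt0 r0 c0); exists i.
rewrite -scalerBr normrZ; move: di; rewrite ltr_pdivlMr// mulrC.
by apply: le_lt_trans; rewrite ler_wpM2r// lerDl.
Qed.

Lemma pmeasN g : pmeas g -> pmeas (fun t => - g t).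
Proof.
by move=> /(pmeasZ (-1)); under eq_fun do rewrite scaleN1r.
Qed.

Lemma pmeasB g g' : pmeas g -> pmeas g' -> pmeas (fun t => g t - g' t).
Proof. by move=> mg /pmeasN; exact: pmeasD. Qed.

Lemma pmeas_indic (A : set R) g : measurable A -> pmeas g ->
  pmeas (fun t => \1_A t *: g t).
Proof.
move=> mA [mg [I [D gD]]]; split => [e|].
  under eq_fun do rewrite dotZr.
  by apply: measurable_funM => //; exact: measurable_indic.
exists (option I), (oapp D 0) => t r r0; rewrite indicE.
case: (t \in A).
  by have [i di] := gD t _ r0; exists (Some i); rewrite scale1r.
by exists None; rewrite scale0r subrr normr0.
Qed.

Lemma pmeas_sum (n : nat) (g : nat -> R -> H) :
  (forall k, (k < n)%N -> pmeas (g k)) ->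
  pmeas (fun t => \sum_(k < n) g k t).
Proof.
elim: n => [|n ih] mg; first by under eq_fun do rewrite big_ord0; exact: pmeas_cst.
under eq_fun do rewrite big_ord_recr/=.
by apply: pmeasD; [apply: ih => k kn; exact/mg/ltnW|exact: mg].
Qed.

Lemma pmeas_cvg (g_ : nat -> R -> H) g : (forall n, pmeas (g_ n)) ->
  (forall t, g_ n t @[n --> \oo] --> g t) -> pmeas g.
Proof.
move=> mg_ g_g; split => [e|].
  apply: (@measurable_fun_cvg _ _ _ _ (fun n t => dot e (g_ n t))) => [n|t _].
    exact: (mg_ n).1.
  exact: (cvg_dot dotE).
have /choice[I ID] := fun n => (mg_ n).2.
pose D n := projT1 (cid (ID n)); have gD n := projT2 (cid (ID n)).
exists {n & I n}, (fun i => D (tag i) (tagged i)) => t r r0.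
have r2 : 0 < r / 2 by rewrite divr_gt0.
have /cvgrPdist_lt/(_ _ r2)[n _ /(_ n (leqnn n)) /= gn] := g_g t.
have [i di] := gD n t _ r2; exists (Tagged I i) => /=.
rewrite -(subrKA (g_ n t)) (le_lt_trans (ler_normD _ _))//.
by rewrite (splitr r) ltrD.
Qed.

(* [`|g|^2] is the countable supremum of the functions
   [2 <D i, g> - `|D i|^2], since [`|g - D i|^2 >= 0]. *)
Lemma pmeas_sqr_norm g : pmeas g -> measurable_fun setT (fun t => `|g t| ^+ 2).
Proof.
move=> [mg [I [D gD]]].
pose k i t := 2 * dot (D i) (g t) - `|D i| ^+ 2.
have kE i t : k i t = `|g t| ^+ 2 - `|g t - D i| ^+ 2.
  by rewrite (sqr_normB dotE) (dotC dot (g t)) /k; ring.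
move=> _; apply: (measurability _ (RGenOInfty.measurableE R)) => //.
move=> _ [_ [x ->] <-]; rewrite setTI preimage_itvoy.
rewrite [X in measurable X](_ : _ = \bigcup_i [set t | x < k i t]).
  apply: countable_bigcupT_measurable => // i.
  rewrite -[X in measurable X]setTI -preimage_itvoy.
  have mk : measurable_fun setT (k i).
    apply: measurable_funB; last exact: measurable_cst.
    by apply: measurable_funM => //; exact: measurable_cst.
  by apply: mk => //; exact: measurable_itv.
apply/seteqP; split => [t /= xt|t [i _] /=]; last first.
  by rewrite kE => /lt_le_trans; apply; rewrite gerBl sqr_ge0.
have d0 : 0 < Num.sqrt (`|g t| ^+ 2 - x) by rewrite sqrtr_gt0 subr_gt0.
have [i di] := gD t _ d0; exists i => //=; rewrite kE.
have : `|g t - D i| ^+ 2 < `|g t| ^+ 2 - x.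
  rewrite -[ltRHS]sqr_sqrtr; last by rewrite subr_ge0 ltW.
  by rewrite ltr_pXn2r// nnegrE// ltW.
lra.
Qed.

Lemma pmeas_norm g : pmeas g -> measurable_fun setT (fun t => `|g t|).
Proof.
move=> mg; rewrite (_ : (fun _ => _) = (fun t => Num.sqrt (`|g t| ^+ 2))).
  apply: measurableT_comp (pmeas_sqr_norm mg).
  by apply: continuous_measurable_fun; exact: sqrt_continuous.
by apply/funext => t; rewrite sqrtr_sqr normr_id.
Qed.

Lemma pmeas_bmeas_dot e g M : pmeas g -> (forall t, `|g t| <= M) ->
  bmeas (fun t => dot e (g t)).
Proof.
move=> [mg _] gM; split => //; exists (`|e| * M) => t.
by rewrite (le_trans (norm_dot_le dotE _ _))// ler_wpM2l.
Qed.

Lemma pmeas_bmeas_norm g M : pmeas g -> (forall t, `|g t| <= M) ->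
  bmeas (fun t => `|g t|).
Proof.
by move=> mg gM; split; [exact: pmeas_norm|exists M => t; rewrite normr_id].
Qed.

End PettisMeasurable.

(** The integral is a supremum over simple functions below the integrand, even a nonmeasurable one.
    A simple function below [u], set to zero on the exceptional null set, keeps its integral and
    lies below [v]. This gives access to the integrals of [|g - s_n|] in the Bochner definition. *)
Lemma ge0_ae_le_integral_nonmeasurable d (T : measurableType d) (R : realType)
    (m : {measure set T -> \bar R}) (D : set T) (u v : T -> \bar R) :
  measurable D -> (forall t, 0 <= u t)%E -> (forall t, 0 <= v t)%E ->
  (\forall t \ae m, D t -> u t <= v t)%E ->
  (\int[m]_(t in D) u t <= \int[m]_(t in D) v t)%E.
Proof.
move=> mD u0 v0 [N [mN N0 uvN]].
rewrite ge0_integralE// [leRHS]ge0_integralE//.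
apply: ge_ereal_sup => _ [h hu <-].
have mN' : measurable (~` N) by exact: measurableC.
rewrite -integralT_nnsfun (ge0_ae_eq_integral (g := EFin \o proj_nnsfun h mN'))//.
- apply: ereal_sup_ubound; exists (proj_nnsfun h mN') => [t|]; last first.
    by rewrite -integralT_nnsfun.
  rewrite -mrestrict /patch; case: ifPn => [tN|_]; last first.
    by case: ifP.
  have := hu t; rewrite /patch; case: ifPn => // tD /le_trans; apply.
  move: tN; rewrite inE /= => tN; move: tD; rewrite inE => tD.
  by apply: contrapT => /negP nuv; apply: tN; apply: uvN => /(_ tD); exact/negP.
- exact/measurable_EFinP.
- exact/measurable_EFinP.
- by move=> t _; rewrite lee_fin.
- by move=> t _; rewrite lee_fin.
- exists N; split => // t /= ht; apply: contrapT => tN; apply: ht => _ /=.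
  by rewrite mindicE mem_set ?mulr1.
Qed.

(** * Bochner integrals through their scalar products *)

Section Bochner.
Context {R : realType} {H : completeNormedModType R}.
Variable dot : {dot H for idfun}.
Hypothesis dotE : induces_norm dot.
Implicit Types (a b M : R) (s g : R -> H) (u v e : H).
Local Notation mu := (@lebesgue_measure R).

Lemma simple_fun_preimage s (A : set H) : simple_fun s ->
  measurable (s @^-1` A : set (measurableTypeR R)).
Proof.
move=> [fs ms]; rewrite (_ : _ @^-1` _ =
    \bigcup_(v in range s `&` A) s @^-1` [set v]).
  by apply: fin_bigcup_measurable => //; exact: finite_setIl.
by apply/seteqP; split => [t At|t [v [_ Av] /= ->]]//; exists (s t).
Qed.

(** A simple function has finitely many values with measurable fibres, so [p] may be arbitrary; the
    discontinuous truncation in [ex_bochner_int] is the case of interest. *)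
Lemma simple_fun_comp (K : completeNormedModType R) (p : H -> K) s :
  simple_fun s -> simple_fun (p \o s).
Proof.
move=> ss; have [fs _] := ss; split => [|v].
  by rewrite -(image_comp s p setT); exact: finite_image.
exact: (simple_fun_preimage (p @^-1` [set v]) ss).
Qed.

Lemma simple_fun_bounded s : simple_fun s -> exists M, forall t, `|s t| <= M.
Proof.
move=> [/finite_compact/compact_bounded[M [_ sM]] _].
by exists (M + 1) => t; apply: sM; [rewrite ltrDl|exists t].
Qed.

Lemma simple_fun_pmeas s : simple_fun s -> pmeas dot s.
Proof.
move=> ss; split => [e _ Y mY|].
  by rewrite setTI; exact: (simple_fun_preimage (dot e @^-1` Y) ss).
have [/finite_fsetP[X sX] _] := ss.
exists X, val => t r r0; have st : s t \in X.
  by have : range s (s t) by []; rewrite sX.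
by exists [` st]%fset; rewrite subrr normr0.
Qed.

Lemma rint_sum (I : eqType) (r : seq I) a b (k : I -> R -> R) :
  (forall i, i \in r -> bmeas (k i)) ->
  rint a b (fun t => \sum_(i <- r) k i t) = \sum_(i <- r) rint a b (k i).
Proof.
move=> mk; suff [//] : rint a b (fun t => \sum_(i <- r) k i t) =
    \sum_(i <- r) rint a b (k i) /\ bmeas (fun t => \sum_(i <- r) k i t).
elim: r mk => [|i r ih] mk.
  rewrite big_nil; under eq_fun do rewrite big_nil.
  split; last exact: bmeas_cst.
  by under [X in rint _ _ X]eq_fun do rewrite -[0](mul0r 0); rewrite rintZ ?mul0r//; exact: bmeas_cst.
have [ihE ihm] := ih (fun j jr => mk j (mem_behead (s := i :: r) jr)).
have mki : bmeas (k i) by apply: mk; rewrite mem_head.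
under eq_fun do rewrite big_cons.
by rewrite rintD// big_cons ihE; split => //; exact: bmeasD.
Qed.

Lemma bmeas_indic (A : set R) : measurable A -> bmeas (\1_A : R -> R).
Proof.
move=> mA; split; first exact: measurable_indic.
by exists 1 => t; rewrite indicE; case: (t \in A); rewrite ?normr1 ?normr0.
Qed.

Lemma rint_indic a b (A : set R) : measurable A ->
  rint a b \1_A = fine (mu (`[a, b] `&` A)).
Proof. by move=> mA; rewrite /rint /Rintegral integral_indic// setIC. Qed.

Lemma dot_simple_int a b s e : simple_fun s ->
  dot e (simple_int a b s) = rint a b (fun t => dot e (s t)).
Proof.
move=> ss; have [fs ms] := ss.
rewrite /simple_int fsbig_finite// dot_sumr; set r := (fset_set _ : seq _).
have mem_r t : s t \in r by rewrite in_fset_set// inE; exists t.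
have -> : (fun t => dot e (s t)) =
    (fun t => \sum_(v <- r) dot e v * \1_(s @^-1` [set v]) t).
  apply/funext => t; rewrite (bigD1_seq (s t))//; last exact: fset_uniq.
  rewrite indicE mem_set// mulr1 big1 /=; first by rewrite addr0.
  by move=> v vs; rewrite indicE memNset ?mulr0//= => /esym/eqP; exact/negP.
rewrite rint_sum; last by move=> v _; apply: bmeasZ; apply: bmeas_indic; exact: ms.
apply: eq_bigr => v _; rewrite dotZr rintZ; last by apply: bmeas_indic; exact: ms.
by rewrite [LHS]mulrC; congr (_ * _); rewrite rint_indic//; exact: ms.
Qed.

(** Convergence and bound both hold on [A], the interval minus a Borel null set. Multiplication by
    the indicator of [A] makes the simple functions converge everywhere, to a function bounded
    everywhere. *)
Lemma strongly_measurable_pmeas a b g M : 0 <= M ->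
  strongly_measurable a b g ->
  {ae mu, forall t, t \in `[a, b] -> `|g t| <= M} ->
  exists g', [/\ pmeas dot g', forall t, `|g' t| <= M &
    {ae mu, forall t, a <= t <= b -> g' t = g t}].
Proof.
move=> M0 [s_ [ss sg]] gM.
have [N [mN N0 subN]] : {ae mu, forall t, t \in `[a, b] ->
    s_ n t @[n --> \oo] --> g t /\ `|g t| <= M}.
  by apply: filterS2 sg gM => t + + tab => /(_ tab) ? /(_ tab).
pose A := `[a, b]%classic `\` N.
have AP t : A t -> s_ n t @[n --> \oo] --> g t /\ `|g t| <= M.
  by move=> [tab tN]; apply: contrapT => ht; apply: tN; apply: subN => /(_ tab).
have mA : measurable A by apply: measurableD.
exists (fun t => \1_A t *: g t); split.
- apply: (@pmeas_cvg _ _ _ dotE (fun n t => \1_A t *: s_ n t)) => [n|t].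
    by apply: pmeas_indic => //; apply: simple_fun_pmeas.
  have [At|At] := pselect (A t).
    rewrite indicE mem_set// scale1r; under eq_fun do rewrite scale1r.
    by have [] := AP t At.
  rewrite indicE memNset// scale0r; under eq_fun do rewrite scale0r.
  exact: cvg_cst.
- move=> t; have [At|At] := pselect (A t).
    by rewrite indicE mem_set// scale1r; have [] := AP t At.
  by rewrite indicE memNset// scale0r normr0.
- exists N; split => // t /= ht; apply: contrapT => tN; apply: ht => tab.
  by rewrite indicE mem_set ?scale1r//; split => //=; rewrite in_itv.
Qed.

Lemma dot_rint_le a b e M g : 0 <= M -> a <= b -> pmeas dot g ->
  (forall t, `|g t| <= M) ->
  `|rint a b (fun t => dot e (g t))| <= `|e| * rint a b (fun t => `|g t|).
Proof.
move=> M0 ab mg gM.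
have mdg := pmeas_bmeas_dot dotE e mg gM.
rewrite (le_trans (rint_norm_le a b mdg))// -rintZ; last first.
  exact: pmeas_bmeas_norm gM.
apply: rint_le => [||t _]; [exact: bmeas_norm| |exact: norm_dot_le].
by apply: bmeasZ; exact: pmeas_bmeas_norm gM.
Qed.

Lemma cvgn_of_dist (w : nat -> H) (c : nat -> R) :
  (forall n m, `|w n - w m| <= c n + c m) -> c n @[n --> \oo] --> 0 -> cvgn w.
Proof.
move=> wc c0; apply/cauchy_cvgP/cauchyP => r r0.
have r2 : 0 < r / 2 by rewrite divr_gt0.
have /cvgrPdist_lt/(_ _ r2)[N _ cN] := c0.
have {}cN n : (N <= n)%N -> c n < r / 2.
  by move=> /cN /=; rewrite sub0r normrN; apply: le_lt_trans; exact: ler_norm.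
exists (w N), N => // n /= Nn; rewrite -ball_normE /=.
by rewrite (le_lt_trans (wc _ _))// (splitr r) ltrD// cN.
Qed.

Section BochnerInt.
Variables (a b M : R) (g g' : R -> H).
Hypothesis (ab : a <= b) (M0 : 0 <= M).
Hypothesis (mg' : pmeas dot g') (g'M : forall t, `|g' t| <= M).
Hypothesis gg' : {ae mu, forall t, a <= t <= b -> g' t = g t}.

Lemma simple_dist_rint (s : R -> H) : simple_fun s ->
  (\int[mu]_(t in `[a, b]) `|g t - s t|%:E)%E =
  (rint a b (fun t => `|g' t - s t|))%:E.
Proof.
move=> ss; have [N sN] := simple_fun_bounded ss.
have N0 : 0 <= N by apply: le_trans (sN 0).
have ms := simple_fun_pmeas ss.
rewrite -rint_EFin; last first.
  apply: (pmeas_bmeas_norm dotE (M := M + N)); first exact: pmeasB.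
  by move=> t; rewrite (le_trans (ler_normB _ _))// lerD.
apply/eqP; rewrite eq_le; apply/andP; split;
  apply: ge0_ae_le_integral_nonmeasurable => //;
  by apply: filterS gg' => t gt /=; rewrite in_itv/= => /gt ->.
Qed.

(** For simple functions the pairing commutes with the integral, and the error is at most [|e|]
    times the [L^1] distance to [g']. Bochner integrals are used below only through these pairings,
    which determine a vector. *)
Lemma is_bochner_int_dot I e : is_bochner_int a b g I ->
  dot e I = rint a b (fun t => dot e (g' t)).
Proof.
move=> [s_ [[ss _] gs sI]].
have sI' : dot e (simple_int a b (s_ n)) @[n --> \oo] --> dot e I.
  exact: (cvg_dot dotE).
apply: (cvg_unique _ sI') => //.
have c0 : rint a b (fun t => `|g' t - s_ n t|) @[n --> \oo] --> 0.
  by move: gs; under eq_fun do rewrite simple_dist_rint//; move=> /fine_cvg.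
apply/cvgrPdist_le => r r0.
have e1 : 0 < `|e| + 1 by rewrite ltr_wpDl.
have /cvgrPdist_le/(_ _ (divr_gt0 r0 e1)) := c0.
apply: filterS => n; rewrite sub0r normrN => cn.
have [N sN] := simple_fun_bounded (ss n).
have N0 : 0 <= N by apply: le_trans (sN 0).
have ms := simple_fun_pmeas (ss n).
rewrite dot_simple_int// -rintB; last 2 first.
- exact: pmeas_bmeas_dot g'M.
- exact: pmeas_bmeas_dot sN.
under [X in rint _ _ X]eq_fun do rewrite -dotBr.
have MN0 : 0 <= M + N by rewrite addr_ge0.
have gsMN t : `|g' t - s_ n t| <= M + N.
  by rewrite (le_trans (ler_normB _ _))// lerD.
apply: (le_trans (dot_rint_le e MN0 ab (pmeasB mg' ms) gsMN)).
apply: (@le_trans _ _ ((`|e| + 1) * rint a b (fun t => `|g' t - s_ n t|))).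
  by rewrite ler_wpM2r ?rint_ge0// lerDl.
rewrite mulrC -ler_pdivlMr//; exact: le_trans (ler_norm _) cn.
Qed.

Lemma ex_bochner_int : strongly_measurable a b g ->
  exists I, is_bochner_int a b g I.
Proof.
move=> [s_ [ss sg]].
(* The given simple functions need not be uniformly bounded; once truncated they admit dominated
   convergence. The level [M + 1] exceeds [|g t|] strictly at almost every [t], so the truncation is
   eventually inactive there. *)
pose p (v : H) : H := if `|v| <= M + 1 then v else 0.
have pM v : `|p v| <= M + 1.
  by rewrite /p; case: ifP => // _; rewrite normr0 addr_ge0.
pose s' n := p \o s_ n.
have ss' n : simple_fun (s' n) by exact: simple_fun_comp.
have ms' n := simple_fun_pmeas (ss' n).
have s'g : {ae mu, forall t : R, t \in `[a, b] -> s' n t @[n --> \oo] --> g t}.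
  apply: filterS2 gg' sg => t + + tab; move: (tab); rewrite in_itv/= => tab'.
  move=> /(_ tab') g't /(_ tab) sgt.
  have gM : `|g t| < M + 1 by rewrite -g't (le_lt_trans (g'M t))// ltrDl.
  apply: cvg_trans (sgt); apply: near_eq_cvg.
  have : \forall n \near \oo, `|s_ n t| < M + 1.
    by apply: cvgr_norm_lt sgt _ _ => //; exact: gM.
  by apply: filterS => n sn; rewrite /s' /= /p ltW.
have c0 : rint a b (fun t => `|g' t - s' n t|) @[n --> \oo] --> 0.
  rewrite (_ : 0 = rint a b (fun=> 0)); last by rewrite rint_cst// mulr0.
  have g's' n t : `|g' t - s' n t| <= M + (M + 1).
    by rewrite (le_trans (ler_normB _ _))// lerD// pM.
  apply: (@rint_cvg _ _ _ (M + (M + 1))).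
  - by move=> n; apply: pmeas_bmeas_norm (g's' n) => //; exact: pmeasB.
  - by move=> n t; rewrite normr_id.
  - exact: bmeas_cst.
  apply: filterS2 gg' s'g => t + + tab; rewrite in_itv/= => /(_ tab) -> /(_ tab) s'gt.
  rewrite -(normr0 H) -(subrr (g t)); apply: cvg_norm; apply: cvgB => //.
  exact: cvg_cst.
have cs : cvgn (fun n => simple_int a b (s' n)).
  apply: cvgn_of_dist c0 => n m; apply: (norm_le_dot dotE).
    by rewrite addr_ge0 ?rint_ge0.
  move=> e; rewrite (dotBr dot e (simple_int a b (s' n))) !dot_simple_int//.
  have bs k : bmeas (fun t => dot e (s' k t)).
    exact: (pmeas_bmeas_dot dotE e (ms' k) (fun t => pM (s_ k t))).
  have bg : bmeas (fun t => dot e (g' t)) by exact: pmeas_bmeas_dot g'M.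
  have s'g' k t : `|g' t - s' k t| <= M + (M + 1).
    by rewrite (le_trans (ler_normB _ _))// lerD// pM.
  have MM0 : 0 <= M + (M + 1) by rewrite !addr_ge0.
  have h k : `|rint a b (fun t => dot e (g' t)) - rint a b (fun t => dot e (s' k t))|
      <= `|e| * rint a b (fun t => `|g' t - s' k t|).
    rewrite -rintB//; under [X in rint _ _ X]eq_fun do rewrite -dotBr.
    exact: (dot_rint_le e MM0 ab (pmeasB mg' (ms' k)) (s'g' k)).
  apply: (le_trans (ler_norm _)); rewrite mulrC mulrDr.
  apply: le_trans (lerD (h n) (h m)).
  by apply: le_trans (ler_normB _ _); rewrite -normrN; rewrite le_eqVlt; apply/orP; left; apply/eqP; congr `|_|; ring.
exists (limn (fun n => simple_int a b (s' n))), s'; split => //.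
by under eq_fun do rewrite simple_dist_rint//; apply: cvg_EFin => //; exact: nearW.
Qed.

Lemma bochner_int_dot e : strongly_measurable a b g ->
  dot e (bochner_int a b g) = rint a b (fun t => dot e (g' t)).
Proof.
move=> mg; apply: is_bochner_int_dot; rewrite /bochner_int.
exact: (xgetPex 0 (ex_bochner_int mg)).
Qed.

End BochnerInt.

End Bochner.

(** * Differentiation of primitives *)

Lemma ae_forall_countable (R : realType) (I : countType) (P : I -> R -> Prop) :
  (forall i, {ae @lebesgue_measure R, forall t, P i t}) ->
  {ae @lebesgue_measure R, forall t, forall i, P i t}.
Proof.
move=> aeP; have : {ae @lebesgue_measure R, forall t, forall n,
    if @choice.unpickle I n is Some i then P i t else True}.
  apply: (@ae_foralln _ _ _ (@lebesgue_measure R)) => n.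
  by case: (choice.unpickle n) => [i|]; [exact: aeP|exact: aeW].
by apply: filterS => t Pt i; have := Pt (choice.pickle i); rewrite choice.pickleK.
Qed.

Section Primitive.
Context {R : realType} {H : completeNormedModType R}.
Variable dot : {dot H for idfun}.
Hypothesis dotE : induces_norm dot.
Local Notation mu := (@lebesgue_measure R).

Lemma bmeas_locally_integrable (k : R -> R) :
  bmeas k -> locally_integrable setT k.
Proof.
move=> mk; split; [exact: mk.1|exact: openT|move=> K _ cK].
have [B [_ KB]] := compact_bounded cK.
have BB1 : B < B + 1 by rewrite ltrDl.
have KB1 : K `<=` `[- (B + 1), B + 1].
  by move=> t Kt; have /= := KB (B + 1) BB1 t Kt; rewrite in_itv/= ler_norml.
have := @ge0_subset_integral _ _ _ mu _ _ (compact_measurable cK)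
  (measurable_itv _) (fun t => `|k t|%:E) _ _ KB1.
move=> /(_ _ _)/le_lt_trans; apply => //.
  by apply/measurable_EFinP; exact: measurable_funS (bmeas_norm mk).1.
by rewrite rint_EFin ?ltry//; exact: bmeas_norm.
Qed.

(** An interval with end points within [h] of [t] lies in the open ball of radius [2 * h], of
    measure [4 * h], on which the mean is at most [r / 4]. The doubled radius admits end points at
    distance exactly [h]. *)
Lemma lebesgue_pt_rint_le (k : R -> R) (t r : R) : bmeas k -> lebesgue_pt k t ->
  0 < r -> exists2 d, 0 < d & forall a b h, `|t - a| <= h -> `|t - b| <= h ->
    0 < h < d -> rint a b (fun s => `|k s - k t|) <= r * h.
Proof.
move=> mk /fine_cvgP[kfin kt] r0.
have r4 : 0 < r / 4 by rewrite divr_gt0.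
have mkt : bmeas (fun s => `|k s - k t|).
  by apply: bmeas_norm; apply: bmeasB => //; exact: bmeas_cst.
move/cvgrPdist_le : kt => /(_ _ r4) kt.
have [d /= d0 {kfin kt} kd] : \forall p \near 0^'+, (davg k t p <= (r / 4)%:E)%E.
  near=> p; rewrite -[leLHS]fineK; last by near: p.
  rewrite lee_fin (le_trans (ler_norm _))// -normrN -sub0r.
  by near: p.
exists (d / 2) => [|a b h ah bh /andP[h0 hd]]; first by rewrite divr_gt0.
have hh0 : 0 < h * 2 by rewrite mulr_gt0.
have hh : h * 2 < d by rewrite -ltr_pdivlMr.
have := kd (h * 2); rewrite /ball/= sub0r normrN gtr0_norm// => /(_ hh hh0).
rewrite /davg /iavg lebesgue_measure_ball ?(ltW hh0)// inver.
rewrite gt_eqF ?mulrn_wgt0// muleC lee_pdivrMr ?mulrn_wgt0// -EFinM => I_le.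
have sub : `[a, b] `<=` ball t (h * 2).
  move=> s /=; rewrite in_itv/= => /andP[as_ sb]; rewrite /ball/=.
  move: ah bh; rewrite !ler_norml ltr_norml => /andP[? ?] /andP[? ?].
  by apply/andP; split; lra.
rewrite -lee_fin -rint_EFin//; apply: (le_trans _ (le_trans I_le _)).
  apply: ge0_subset_integral => //; first exact: measurable_ball.
  by apply/measurable_EFinP; exact: measurable_funS mkt.1.
by rewrite lee_fin; lra.
Unshelve. all: by end_near. Qed.

Variables (T M : R) (g x : R -> H) (x0 : H).
Hypotheses (T0 : 0 <= T) (M0 : 0 <= M).
Hypotheses (mg : pmeas dot g) (gM : forall t, `|g t| <= M).
Hypothesis xE : forall e t, 0 <= t <= T ->
  dot e (x t - x0) = rint 0 t (fun s => dot e (g s)).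

Let mdg e : bmeas (fun s => dot e (g s)).
Proof. exact: pmeas_bmeas_dot gM. Qed.

Lemma primitive_increment e a b : 0 <= a -> a <= b -> b <= T ->
  dot e (x b - x a) = rint a b (fun s => dot e (g s)).
Proof.
move=> a0 ab bT; rewrite -(subrKA x0) (dotDr dot e (x b - x0)) -(opprB (x a)).
rewrite (dotNr dot e (x a - x0)) !xE; last 2 first.
- by rewrite a0 (le_trans ab).
- by rewrite bT (le_trans a0).
rewrite (@rint_split _ 0 b a)//; last by rewrite a0.
by rewrite addrAC subrr add0r.
Qed.

Lemma primitive_dist a b v : 0 <= a -> a <= b -> b <= T ->
  `|x b - x a - (b - a) *: v| <= rint a b (fun s => `|g s - v|).
Proof.
move=> a0 ab bT; apply: (norm_le_dot dotE).
  by apply: rint_ge0.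
move=> e; rewrite (dotBr dot e (x b - x a)) (dotZr dot (b - a)).
rewrite primitive_increment// -(rint_cst (dot e v) ab) -rintB//; last first.
  exact: bmeas_cst.
under [X in rint _ _ X]eq_fun do rewrite -dotBr.
rewrite mulrC (le_trans (ler_norm _))//.
apply: (@dot_rint_le _ _ _ dotE a b e (M + `|v|)) => //.
- by rewrite addr_ge0.
- by apply: pmeasB => //; exact: pmeas_cst.
- by move=> s; rewrite (le_trans (ler_normB _ _))// lerD.
Qed.

Lemma primitive_lipschitz a b : 0 <= a <= T -> 0 <= b <= T ->
  `|x b - x a| <= M * `|b - a|.
Proof.
wlog ab : a b / a <= b.
  move=> h ha hb; have [/h|/ltW/h] := leP a b; first exact.
  by rewrite distrC (distrC b); apply.
move=> /andP[a0 _] /andP[_ bT].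
have := primitive_dist 0 a0 ab bT; rewrite scaler0 subr0 => /le_trans; apply.
rewrite (@ger0_norm _ (b - a)) ?subr_ge0// mulrC -(rint_cst M ab).
apply: rint_le => [||s _]; last by rewrite subr0.
  apply: (pmeas_bmeas_norm dotE (M := M)); last by move=> s; rewrite subr0.
  by apply: pmeasB => //; exact: pmeas_cst.
exact: bmeas_cst.
Qed.

(** Scalar Lebesgue points suffice: some [D i] is within [r / 4] of [g t], and [|g s - g t|] is at
    most [|k i s - k i t| + 2 * k i t], whose first term is small in mean near [t]. The end points
    of the interval are discarded because the derivative is two-sided. *)
Lemma primitive_derivable : {ae mu, forall t, t \in `[0, T] ->
  derivable x t 1 /\ 'D_1 x t = g t}.
Proof.
have [I [D gD]] := mg.2.
pose k i s := `|g s - D i|.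
have mk i : bmeas (k i).
  apply: (pmeas_bmeas_norm dotE (M := M + `|D i|)).
    by apply: pmeasB => //; exact: pmeas_cst.
  by move=> s; rewrite (le_trans (ler_normB _ _))// lerD.
have := ae_forall_countable (fun i =>
  lebesgue_differentiation (bmeas_locally_integrable (mk i))).
apply: filterS3 (lebesgue_ae_neq 0) (lebesgue_ae_neq T) => t t0 tT tk; rewrite in_itv/= => /andP[t_ge0 t_leT].
have {}t0 : 0 < t by rewrite lt_neqAle eq_sym t0.
have {}tT : t < T by rewrite lt_neqAle tT.
suff xt : h^-1 *: ((x \o shift t) (h *: 1) - x t) @[h --> 0^'] --> g t.
  by split; [apply/cvg_ex; exists (g t)|exact: cvg_lim].
apply/cvgrPdist_le => r r0.
have r4 : 0 < r / 4 by rewrite divr_gt0.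
have [i di] := gD t _ r4.
have [d d0 kd] := lebesgue_pt_rint_le (mk i) (tk i) r4.
have tTt : 0 < Num.min t (T - t) by rewrite lt_min t0 subr_gt0.
have key a b h : 0 <= a -> a <= b -> b <= T -> `|t - a| <= h -> `|t - b| <= h ->
    b - a <= h -> 0 < h < d -> `|x b - x a - (b - a) *: g t| <= r * h.
  move=> a0 ab bT ah bh bah hd.
  apply: (le_trans (primitive_dist (g t) a0 ab bT)).
  have mkt : bmeas (fun s => `|k i s - k i t|).
    by apply: bmeas_norm; apply: bmeasB => //; exact: bmeas_cst.
  apply: (@le_trans _ _ (rint a b (fun s => `|k i s - k i t| + 2 * k i t))).
    apply: rint_le.
    - apply: (pmeas_bmeas_norm dotE (M := M + `|g t|)).
        by apply: pmeasB => //; exact: pmeas_cst.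
      by move=> s; rewrite (le_trans (ler_normB _ _))// lerD.
    - by apply: bmeasD => //; exact: bmeas_cst.
    move=> s _; rewrite -(subrKA (D i)).
    rewrite (le_trans (ler_normD _ _))// (distrC (D i) (g t)) -/(k i t) -/(k i s).
    by have := ler_norm (k i s - k i t); lra.
  rewrite rintD//; last exact: bmeas_cst.
  rewrite rint_cst//; have := kd _ _ _ ah bh hd.
  have : (b - a) * (2 * k i t) <= h * (2 * (r / 4)).
    apply: ler_pM; rewrite ?subr_ge0// ?mulr_ge0 ?/k//.
    by rewrite ler_pM2l// ltW.
  have /andP[h0 _] := hd; have : 0 < r * h by rewrite mulr_gt0.
  by lra.
near=> h.
have h0 : h != 0 by near: h; exact: nbhs_dnbhs_neq.
have nh0 : 0 < `|h| by rewrite normr_gt0.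
have hd : `|h| < d.
  by near: h; apply: dnbhs0_lt.
have /andP[ht hT] : (`|h| < t) && (`|h| < T - t).
  by rewrite -lt_min; near: h; apply: dnbhs0_lt.
have -> : g t - h^-1 *: ((x \o shift t) (h *: 1) - x t) =
    - (h^-1 *: (x (h + t) - x t - h *: g t)).
  by rewrite /= (_ : h *: 1 = h) ?scalerBr ?scalerA ?mulVf// ?scale1r ?opprB// /GRing.scale/= mulr1.
rewrite normrN normrZ normfV ler_pdivrMl// mulrC.
have [hp|hn] := ltP 0 h.
  move: hd ht hT; rewrite (gtr0_norm hp) => hd ht hT.
  have -> : x (h + t) - x t - h *: g t = x (h + t) - x t - (h + t - t) *: g t.
    by rewrite addrK.
  apply: key.
  - exact: ltW.
  - by rewrite lerDr ltW.
  - by rewrite -lerBrDr ltW.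
  - by rewrite subrr normr0 ltW.
  - by rewrite opprD addrCA subrr addr0 normrN gtr0_norm.
  - by rewrite addrK.
  - by rewrite hp.
have hn0 : h < 0 by rewrite lt_neqAle h0.
move: hd ht hT; rewrite (ler0_norm hn) => hd ht hT.
rewrite -normrN.
have -> : - (x (h + t) - x t - h *: g t) = x t - x (h + t) - (t - (h + t)) *: g t.
  by rewrite opprB opprB addrC opprD addrCA subrr addr0 scaleNr opprK.
apply: key.
- by rewrite -lerBlDr sub0r ltW // ltrNl.
- by rewrite gerDr.
- exact: ltW.
- by rewrite opprD addrCA subrr addr0 normrN ler0_norm.
- by rewrite subrr normr0 oppr_ge0.
- by rewrite opprD addrCA subrr addr0.
- by rewrite oppr_gt0 hn0.
Unshelve. all: by end_near. Qed.

End Primitive.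

(** * The catching-up scheme *)

Section Scheme.
Context {R : realType} {H : completeNormedModType R}.
Variable dot : {dot H for idfun}.
Hypothesis dotE : induces_norm dot.
Implicit Types (a b M : R) (g : R -> H).
Local Notation mu := (@lebesgue_measure R).

Lemma strongly_measurable_sub a b a' b' g : a <= a' -> b' <= b ->
  strongly_measurable a b g -> strongly_measurable a' b' g.
Proof.
move=> aa bb [s_ [ss sg]]; exists s_; split => //.
apply: filterS sg => t + tab; apply; move: tab; rewrite !in_itv/=.
by move=> /andP[/(le_trans aa)-> /le_trans->].
Qed.

Lemma bochner_int_norm_le a b g g' M : a <= b -> 0 <= M ->
  pmeas dot g' -> (forall t, `|g' t| <= M) ->
  {ae mu, forall t, a <= t <= b -> g' t = g t} ->
  strongly_measurable a b g -> `|bochner_int a b g| <= (b - a) * M.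
Proof.
move=> ab M0 mg' g'M gg' mg; apply: (norm_le_dot dotE) => [|e].
  by rewrite mulr_ge0 ?subr_ge0.
rewrite (bochner_int_dot dotE ab M0 mg' g'M gg' e mg).
rewrite (le_trans (ler_norm _))// (le_trans (dot_rint_le dotE e M0 ab mg' g'M))//.
rewrite mulrC ler_wpM2r// -(rint_cst M ab); apply: rint_le => //.
  exact: pmeas_bmeas_norm g'M.
exact: bmeas_cst.
Qed.

Lemma eq_rint_oc a b (k l : R -> R) : bmeas k -> bmeas l ->
  (forall t, a < t <= b -> k t = l t) -> rint a b k = rint a b l.
Proof.
move=> mk ml kl; apply: ae_eq_rint => //.
apply: filterS (lebesgue_ae_neq a) => t ta /andP[at_ tb]; apply: kl.
by rewrite tb lt_neqAle at_ eq_sym ta.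
Qed.

Lemma dist_to_ge0 (S : set H) w : 0 <= dist_to S w.
Proof.
have [S0|/set0P S0] := eqVneq S set0; last first.
  apply: lb_le_inf; first by have [z Sz] := S0; exists `|w - z|; exists z.
  by move=> _ [z _ <-].
by rewrite /dist_to S0 image_set0 inf0.
Qed.

Lemma dist_to_le (S : set H) w z : S z -> dist_to S w <= `|w - z|.
Proof.
move=> Sz; apply: ge_inf; last by exists z.
by exists 0 => _ [? _ <-].
Qed.

(** The point [p] competes in the projection, so the distance from [p + z] to [S] is at most [|z|];
    the rest is [|z|^2 + e <= (|z| + sqrt e)^2]. *)
Lemma approx_proj_dist_le (S : set H) (e : R) p z q : 0 <= e -> S p ->
  approx_proj e S (p + z) q -> `|p + z - q| <= `|z| + Num.sqrt e.
Proof.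
move=> e0 Sp [Sq /ltW hq]; rewrite -(@ler_pXn2r _ 2)// ?nnegrE//.
  apply: le_trans hq _.
  have : dist_to S (p + z) ^+ 2 <= `|z| ^+ 2.
    rewrite ler_pXn2r// ?nnegrE// ?dist_to_ge0//.
    by rewrite (le_trans (dist_to_le (p + z) Sp))// addrAC subrr add0r.
  rewrite sqrrD sqr_sqrtr// -mulr_natr.
  have : 0 <= `|z| * Num.sqrt e by rewrite mulr_ge0// sqrtr_ge0.
  lra.
Qed.

(** Induction gives [k * m * B * (1 + m * L) ^+ k], and [1 + x <= exp x]. The final bound depends on
    [n] and [m] only through [n * m], which equals [T] for every subdivision. *)
Lemma discrete_gronwall (a : nat -> R) (m B L : R) (n : nat) :
  0 <= m -> 0 <= B -> 0 <= L -> a 0%N = 0 ->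
  (forall k, (k < n)%N -> a k.+1 <= a k + m * (B + L * a k)) ->
  forall k, (k <= n)%N -> a k <= n%:R * m * B * expR (n%:R * m * L).
Proof.
move=> m0 B0 L0 a0 ak.
have claim k : (k <= n)%N -> a k <= k%:R * m * B * (1 + m * L) ^+ k.
  elim: k => [|k ih] kn; first by rewrite a0 !mul0r.
  have {}ih := ih (ltnW kn); apply: le_trans (ak k kn) _.
  have mL : 1 <= 1 + m * L by rewrite lerDl mulr_ge0.
  have pk : 1 <= (1 + m * L) ^+ k.+1 by exact: exprn_ege1.
  have : a k * (1 + m * L) <= k%:R * m * B * (1 + m * L) ^+ k.+1.
    by rewrite exprSr mulrA ler_wpM2r// (le_trans _ mL).
  have : m * B * 1 <= m * B * (1 + m * L) ^+ k.+1 by rewrite ler_wpM2l ?mulr_ge0.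
  by rewrite -[k.+1%:R]natr1; lra.
move=> k kn; apply: le_trans (claim k kn) _.
apply: ler_pM; rewrite ?mulr_ge0// ?exprn_ge0// ?addr_ge0 ?mulr_ge0//.
  by rewrite -!mulrA ler_wpM2r ?mulr_ge0// ler_nat.
apply: (@le_trans _ _ ((1 + m * L) ^+ n)).
  by apply: ler_weXn2l => //; rewrite lerDl mulr_ge0.
rewrite -mulrA expRM_natl lerXn2r ?nnegrE ?expR_ge0//.
  by rewrite addr_ge0// mulr_ge0.
exact: expR_ge1Dx.
Qed.

Section Piecewise.
Variables (T : R) (n : nat).
Hypotheses (T0 : 0 < T) (n0 : (0 < n)%N).

Lemma step_gt0 : 0 < step T n.
Proof. by rewrite divr_gt0// ltr0n. Qed.

Lemma nodeS k : node T n k.+1 = node T n k + step T n.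
Proof. by rewrite /node -natr1 mulrDl mul1r. Qed.

Lemma node0 : node T n 0 = 0.
Proof. by rewrite /node mul0r. Qed.

Lemma noden : node T n n = T.
Proof. by rewrite /node /step mulrC divfK// pnatr_eq0 -lt0n. Qed.

Lemma node_le : {homo node T n : k l / (k <= l)%N >-> k <= l}.
Proof. by move=> k l kl; rewrite ler_wpM2r ?ler_nat// ltW// step_gt0. Qed.

Lemma node_ge0 k : 0 <= node T n k.
Proof. by rewrite -node0 node_le. Qed.

Lemma node_leT k : (k <= n)%N -> node T n k <= T.
Proof. by move=> kn; rewrite -[leRHS]noden node_le. Qed.

Lemma node_cell t : 0 < t <= T ->
  exists2 k, (k < n)%N & node T n k < t <= node T n k.+1.
Proof.
move=> /andP[t0 tT]; have ex : exists k, t <= node T n k.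
  by exists n; rewrite noden.
have [k tk kmin] := ex_minnP ex.
have kn : (k <= n)%N by apply: kmin; rewrite noden.
case: k tk kn kmin => [|k] tk kn kmin.
  by move: tk; rewrite node0 leNgt t0.
exists k => //; rewrite tk andbT ltNge; apply/negP => /kmin.
by rewrite ltnn.
Qed.

(** The cells are those of the interpolant, open on the left, so the value is [0] at time [0] and
    outside the interval. The sum form lets measurability follow from that of the pieces. *)
Definition piecewise (G : nat -> R -> H) (t : R) : H :=
  \sum_(k < n) \1_(`]node T n k, node T n k.+1]) t *: G k t.

Lemma piecewiseE (G : nat -> R -> H) k t : (k < n)%N ->
  node T n k < t <= node T n k.+1 -> piecewise G t = G k t.
Proof.
move=> kn tk; rewrite /piecewise (bigD1 (Ordinal kn))//= big1 => [|j jk].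
  by rewrite addr0 indicE mem_set ?scale1r//= in_itv.
rewrite indicE memNset ?scale0r//= in_itv/= => /andP[jt tj].
have /andP[kt tk'] := tk.
have : node T n k < node T n j.+1 by exact: lt_le_trans tj.
rewrite ltNge => /negP; apply; apply: node_le; rewrite ltnNge; apply/negP => kj.
have : node T n j < node T n k.+1 by exact: lt_le_trans tk'.
rewrite ltNge => /negP; apply; apply: node_le; rewrite ltn_neqAle kj andbT.
by apply: contra_neqN jk => /eqP kj'; apply/val_inj.
Qed.

Lemma pmeas_piecewise (G : nat -> R -> H) :
  (forall k, (k < n)%N -> pmeas dot (G k)) -> pmeas dot (piecewise G).
Proof.
move=> mG; apply: (@pmeas_sum _ _ dot n
  (fun k t => \1_(`]node T n k, node T n k.+1]) t *: G k t)) => k kn.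
by apply: pmeas_indic; [exact: measurable_itv|exact: mG].
Qed.

Lemma piecewise_norm_le (G : nat -> R -> H) M : 0 <= M ->
  (forall k t, (k < n)%N -> `|G k t| <= M) -> forall t, `|piecewise G t| <= M.
Proof.
move=> M0 GM t; have [/node_cell[k kn tk]|tT] := boolP (0 < t <= T).
  by rewrite (piecewiseE G kn tk) GM.
rewrite /piecewise big1 ?normr0// => k _; rewrite indicE memNset ?scale0r//=.
rewrite in_itv/= => /andP[kt tk]; move/negP: tT; apply.
by rewrite (le_lt_trans (node_ge0 k))// (le_trans tk)// node_leT.
Qed.

End Piecewise.

Variables (T : R) (C : set H) (h : H -> R) (Lh gamma : R) (f : R -> H -> H).
Variables (ft : H -> R -> H) (x0 : H).
Hypotheses (T0 : 0 < T) (Lh0 : 0 <= Lh) (h0 : forall p, 0 <= h p).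
Hypothesis h_lip : forall p q, `|h p - h q| <= Lh * `|p - q|.
Hypothesis mf : forall p, strongly_measurable 0 T (f ^~ p).
Hypothesis mft : forall p, pmeas dot (ft p).
Hypothesis ftM : forall p t, `|ft p t| <= h p + Num.sqrt gamma.
Hypothesis ftE : forall p, {ae mu, forall t, 0 <= t <= T -> ft p t = f t p}.
Hypothesis x0C : C x0.

(** In one step the integral and the projection residual each move the node by at most
    [m * (h + sqrt gamma)], the latter up to an extra [sqrt e <= m]; hence the factor 2 in [B] and
    in [2 * Lh], and the final [1]. Gronwall confines the nodes to the ball of radius [rho] around
    [x0], where [h + sqrt gamma] is at most [K]. *)
Let B := 2 * (h x0 + Num.sqrt gamma) + 1.
Let rho := T * B * expR (T * (2 * Lh)).
Let K := h x0 + Lh * rho + Num.sqrt gamma.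

Lemma scheme_rho_ge0 : 0 <= rho.
Proof.
rewrite /rho !mulr_ge0 ?expR_ge0 ?(ltW T0)//.
by rewrite /B addr_ge0// mulr_ge0// addr_ge0// sqrtr_ge0.
Qed.

Lemma scheme_K_ge0 : 0 <= K.
Proof. by rewrite /K !addr_ge0 ?sqrtr_ge0// mulr_ge0// scheme_rho_ge0. Qed.

(** In the almost everywhere clause, [p] and [q] are the left and right nodes of the cell of [t],
    and [w] is the point of which [q] is an approximate projection. The constant [2 * K + 1] is a
    Lipschitz constant of the interpolant, whose velocity is [P - V]. *)
Lemma scheme_estimates (n : nat) (e : R) (u : R -> H) (y : nat -> H) :
  (0 < n)%N -> 0 < e -> Num.sqrt e <= step T n ->
  catching_up_nodes C f T x0 n e y -> catching_up_interpolant f T x0 n y u ->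
  exists V P : R -> H,
  [/\ pmeas dot V /\ pmeas dot P,
      forall t, `|V t| <= K + 1 /\ `|P t| <= K,
      forall d t, 0 <= t <= T ->
        dot d (u t - x0) = rint 0 t (fun s => dot d (P s - V s)),
      forall t, 0 <= t <= T -> exists p, [/\ C p, `|p - x0| <= rho &
        `|u t - p| <= (2 * K + 1) * step T n] &
      {ae mu, forall t, 0 < t <= T -> exists p q w,
        [/\ `|u t - p| <= (2 * K + 1) * step T n,
            `|u t - q| <= (2 * K + 1) * step T n,
            approx_proj e C w q,
            V t = (step T n)^-1 *: (w - q) /\ P t = f t p &
            `|V t| <= h p + Num.sqrt gamma + Num.sqrt e / step T n /\
            `|P t| <= h p + Num.sqrt gamma]}].
Proof.
move=> n0 e0 e_le [y0 yC] [u0 uE].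
set m := step T n; have m0 : 0 < m := step_gt0 T0 n0.
pose z k := bochner_int (node T n k) (node T n k.+1) (f ^~ (y k)).
have Cy k : (k <= n)%N -> C (y k).
  by case: k => [|k] kn; rewrite ?y0//; have [] := yC k kn.
have hg p : 0 <= h p + Num.sqrt gamma by rewrite addr_ge0 ?sqrtr_ge0.
have ft_node k a b : (k < n)%N -> node T n k <= a -> a <= b ->
    b <= node T n k.+1 -> [/\ 0 <= a, b <= T,
      {ae mu, forall t, a <= t <= b -> ft (y k) t = f t (y k)} &
      strongly_measurable a b (f ^~ (y k))].
  move=> kn ka ab bk.
  have a0 : 0 <= a by exact: le_trans (node_ge0 T0 n0 k) ka.
  have bT : b <= T by apply: le_trans bk _; exact: node_leT.
  split => //; last exact: strongly_measurable_sub (mf (y k)).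
  apply: filterS (ftE (y k)) => t + /andP[at_ tb]; apply.
  by rewrite (le_trans a0)//= (le_trans tb).
have z_le k : (k < n)%N -> `|z k| <= m * (h (y k) + Num.sqrt gamma).
  move=> kn; have nS := node_le T0 n0 (leqnSn k).
  have [_ _ ? ?] := ft_node k _ _ kn (lexx _) nS (lexx _).
  rewrite (_ : m = node T n k.+1 - node T n k); last first.
    by rewrite nodeS addrAC subrr add0r.
  exact: (bochner_int_norm_le nS (hg (y k)) (mft (y k)) (ftM (y k))).
have d_le k : (k < n)%N ->
    `|y k + z k - y k.+1| <= m * (h (y k) + Num.sqrt gamma) + Num.sqrt e.
  move=> kn; apply: le_trans (approx_proj_dist_le (ltW e0) (Cy k (ltnW kn)) (yC k kn)) _.
  by rewrite lerD2r z_le.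
have h_le k : h (y k) <= h x0 + Lh * `|y k - x0|.
  by have := h_lip (y k) x0; rewrite ler_norml => /andP[_]; rewrite lerBlDl.
have y_le k : (k <= n)%N -> `|y k - x0| <= rho.
  have -> : rho = n%:R * m * B * expR (n%:R * m * (2 * Lh)).
    by rewrite -[n%:R * m]/(node T n n) noden.
  apply: (@discrete_gronwall (fun k => `|y k - x0|)).
  - exact: ltW.
  - by rewrite /B addr_ge0// mulr_ge0.
  - by rewrite mulr_ge0.
  - by rewrite y0 subrr normr0.
  move=> k' kn.
  have -> : y k'.+1 - x0 = (y k' - x0) + z k' - (y k' + z k' - y k'.+1).
    by rewrite opprB (addrAC (y k')) [RHS]addrC subrKA.
  apply: le_trans (ler_normB _ _) _.
  have := ler_normD (y k' - x0) (z k').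
  have := z_le _ kn; have := d_le _ kn.
  have : m * (h (y k')) <= m * (h x0 + Lh * `|y k' - x0|) by rewrite ler_pM2l.
  have : Num.sqrt e <= m := e_le.
  by rewrite /B; lra.
have hK k : (k <= n)%N -> h (y k) + Num.sqrt gamma <= K.
  move=> kn; rewrite /K lerD2r (le_trans (h_le k))// lerD2l ler_wpM2l//.
  exact: y_le.
pose nu k := m^-1 *: (y k + z k - y k.+1).
have nu_le k : (k < n)%N ->
    `|nu k| <= h (y k) + Num.sqrt gamma + Num.sqrt e / m.
  move=> kn; rewrite normrZ gtr0_norm ?invr_gt0// ler_pdivrMl// mulrDr.
  by rewrite (mulrCA m) divff ?gt_eqF// mulr1 d_le.
have em : Num.sqrt e / m <= 1 by rewrite ler_pdivrMr// mul1r.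
pose V := piecewise T n (fun k _ => nu k).
pose P := piecewise T n (fun k => ft (y k)).
have mV : pmeas dot V by apply: pmeas_piecewise => k _; exact: pmeas_cst.
have mP : pmeas dot P by apply: pmeas_piecewise => k _; exact: mft.
have K0 := scheme_K_ge0.
have VK t : `|V t| <= K + 1.
  apply: piecewise_norm_le => //; first by rewrite addr_ge0.
  move=> k _ kn; apply: le_trans (nu_le k kn) _.
  by rewrite lerD// hK// ltnW.
have PK t : `|P t| <= K.
  by apply: piecewise_norm_le => // k s kn; apply: le_trans (ftM _ _) _; rewrite hK// ltnW.
have mPV := pmeasB mP mV.
have PVK t : `|P t - V t| <= 2 * K + 1.
  by have := ler_normB (P t) (V t); have := VK t; have := PK t; lra.
have bPV d : bmeas (fun s => dot d (P s - V s)) := pmeas_bmeas_dot dotE d mPV PVK.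
have cell k t d : (k < n)%N -> node T n k < t <= node T n k.+1 ->
    dot d (u t - y k) = rint (node T n k) t (fun s => dot d (P s - V s)).
  move=> kn tk; have /andP[kt tk'] := tk.
  rewrite (uE k t kn tk) -/(z k) -/m.
  have -> : y k.+1 - y k - z k = - (y k + z k - y k.+1).
    by rewrite opprB opprD addrA.
  rewrite -(addrA (y k)) (addrAC (y k)) subrr add0r.
  have [a0 bT aeE sE] := ft_node k _ _ kn (lexx _) (ltW kt) tk'.
  rewrite dotDr (bochner_int_dot dotE (ltW kt) (hg _) (mft _) (ftM _) aeE d sE).
  rewrite scalerN -scalerA -/(nu k) (dotNr dot d) (dotZr dot) -(rint_cst _ (ltW kt)).
  rewrite addrC -rintB; last 2 first.
  - exact: pmeas_bmeas_dot (ftM _).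
  - exact: bmeas_cst.
  (* The left node is not in this cell, so the integrands are compared on the half-open interval
     only. *)
  apply: eq_rint_oc => //.
    apply: bmeasB; [exact: pmeas_bmeas_dot (ftM _)|exact: bmeas_cst].
  move=> s /andP[ks st]; rewrite (dotBr dot d (P s)).
  have sk : node T n k < s <= node T n k.+1 by rewrite ks (le_trans st).
  by rewrite /P /V !(piecewiseE T0 n0 _ kn sk).
have u_node k : (k < n)%N -> u (node T n k.+1) = y k.+1.
  move=> kn; rewrite (uE k)//; last first.
    by rewrite lexx andbT nodeS ltrDl.
  have -> : node T n k.+1 - node T n k = m by rewrite nodeS addrAC subrr add0r.
  by rewrite -/(z k) -/m divff ?gt_eqF// scale1r -addrA subrK addrC subrK.
have u_node' k : (k <= n)%N -> u (node T n k) = y k.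
  by case: k => [|k] kn; [rewrite node0 u0|exact: u_node].
have uxE d t : 0 <= t <= T ->
    dot d (u t - x0) = rint 0 t (fun s => dot d (P s - V s)).
  move=> /andP[t_ge0 tT].
  have nodeE k : (k <= n)%N ->
      dot d (y k - x0) = rint 0 (node T n k) (fun s => dot d (P s - V s)).
    elim: k => [|k ih] kn; first by rewrite y0 subrr dot0r node0 rint_point.
    have kS : node T n k < node T n k.+1 by rewrite nodeS ltrDl.
    rewrite (@rint_split _ 0 _ (node T n k))//; last by rewrite node_ge0 ?ltW.
    have kk : node T n k < node T n k.+1 <= node T n k.+1 by rewrite kS lexx.
    rewrite -(ih (ltnW kn)) -(cell _ _ d kn kk) (u_node _ kn).
    by rewrite -(dotDr dot d (y k - x0)) [X in _ = dot d X]addrC subrKA.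
  move: t_ge0; rewrite le_eqVlt => /predU1P[<-|t_gt0].
    by rewrite u0 subrr dot0r rint_point.
  have [|k kn tk] := @node_cell T n n0 t; first by rewrite t_gt0.
  rewrite (@rint_split _ 0 _ (node T n k))//; last first.
    by rewrite node_ge0//= ltW//; have /andP[] := tk.
  rewrite -(nodeE _ (ltnW kn)) -(cell _ _ d kn tk).
  by rewrite -(dotDr dot d (y k - x0)) [X in _ = dot d X]addrC subrKA.
have near_node k t : (k <= n)%N -> 0 <= t <= T -> `|t - node T n k| <= m ->
    `|u t - y k| <= (2 * K + 1) * m.
  move=> kn tT tk; have K21 : 0 <= 2 * K + 1 by rewrite addr_ge0// mulr_ge0.
  rewrite -u_node'//.
  apply: le_trans (primitive_lipschitz dotE K21 mPV PVK uxE _ tT) _.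
    by rewrite node_ge0//= node_leT.
  by rewrite ler_wpM2l.
exists V, P; split => //.
- move=> t tT; have [->|t0] := eqVneq t 0.
    exists x0; rewrite u0 !subrr normr0 scheme_rho_ge0; split => //.
    by rewrite mulr_ge0 ?(ltW m0)// addr_ge0// mulr_ge0.
  have /andP[t_ge0 t_leT] := tT.
  have [|k kn /andP[kt tk]] := @node_cell T n n0 t.
    by rewrite lt_neqAle eq_sym t0 t_ge0.
  exists (y k); split; [exact/Cy/ltnW|exact/y_le/ltnW|].
  apply: near_node => //; first exact: ltnW.
  by rewrite ger0_norm ?subr_ge0 ?(ltW kt)// lerBlDl -nodeS.
have := ae_forall_countable (fun k : nat => ftE (y k)).
apply: filterS => t ftt tT; have /andP[t_gt0 t_leT] := tT.
have tT' : 0 <= t <= T by rewrite ltW.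
have [k kn tk] := @node_cell T n n0 t tT; have /andP[kt tk'] := tk.
exists (y k), (y k.+1), (y k + z k).
rewrite /V /P !(piecewiseE T0 n0 _ kn tk)//; split => //.
- apply: near_node => //; first exact: ltnW.
  by rewrite ger0_norm ?subr_ge0 ?(ltW kt)// lerBlDl -nodeS.
- apply: near_node => //.
  by rewrite distrC ger0_norm ?subr_ge0// lerBlDl -lerBlDr nodeS addrK ltW.
- exact: yC.
- by split => //; exact: ftt.
- by split; [exact: nu_le|exact: ftM].
Qed.

End Scheme.

(** * Uniform and almost everywhere limits *)

Section Compactness.
Context {R : realType} {H : completeNormedModType R}.

Lemma ultra_limit (U : set_system nat) (A : set H) (p : nat -> H) :
  UltraFilter U -> compact A -> (forall n, A (p n)) ->
  exists2 l, A l & p n @[n --> U] --> l.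
Proof.
move=> UU cA pA.
have UA : U (p @^-1` A) by apply: filterS filterT => n _; exact: pA.
have [l [Al cl]] := cA (p n @[n --> U]) _ UA.
exists l => // B lB; have [//|nB] := in_ultra_setVsetC (p @^-1` B) UU.
by have [y []] := cl (~` B) B nB lB.
Qed.

Lemma increasing_selection (A : nat -> set nat) :
  (forall j m, exists2 n, (m < n)%N & A j n) ->
  exists2 phi : nat -> nat, increasing_seq phi & forall j, A j (phi j).
Proof.
move=> Aex; have /choice[nxt nxtP] : forall jm : nat * nat, exists n,
    (jm.2 < n)%N /\ A jm.1 n.
  by move=> [j m]; have [n ? ?] := Aex j m; exists n.
pose phi := fix phi j := if j is i.+1 then nxt (j, phi i) else nxt (0%N, 0%N).
exists phi; last first.
  case=> [|j] /=; first by have [] := nxtP (0%N, 0%N).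
  by have [] := nxtP (j.+1, phi j).
apply: leq_mono; apply: homo_ltn => [|j]; first exact: ltn_trans.
by have [] := nxtP (j.+1, phi j).
Qed.

(* Pointwise limits along an ultrafilter finer than [\oo] are uniform on [0, T]
   by equicontinuity, so sets of good indices are infinite. *)
Lemma equilipschitz_subsequence (u : nat -> R -> H) (A : set H) (T M : R)
    (c : nat -> R) :
  0 < T -> compact A ->
  (forall n s t, 0 <= s <= T -> 0 <= t <= T ->
     `|u n t - u n s| <= M * `|t - s|) ->
  (forall n t, 0 <= t <= T -> exists2 p, A p & `|u n t - p| <= c n) ->
  c n @[n --> \oo] --> 0 ->
  exists (phi : nat -> nat) (x : R -> H), [/\ increasing_seq phi,
    forall t, 0 <= t <= T -> A (x t) &
    forall r, 0 < r -> exists N, forall j t, (N <= j)%N -> 0 <= t <= T ->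
      `|u (phi j) t - x t| <= r].
Proof.
move=> T0 cA u_lip uA c0.
have M0 : 0 <= M.
  have := u_lip 0%N 0 T; rewrite !lexx (ltW T0) => /(_ isT isT).
  move=> /(le_trans (normr_ge0 _)).
  by rewrite subr0 pmulr_lge0// normr_gt0 gt_eqF.
have [U [UU oU]] := ultraFilterLemma (F := \oo) _.
have cU : c n @[n --> U] --> 0 by apply: cvg_trans c0 => B; exact: oU.
have /choice[x xP] : forall t, exists l,
    0 <= t <= T -> A l /\ u n t @[n --> U] --> l.
  move=> t; have [tT|tT] := pselect (0 <= t <= T); last by exists 0.
  (* The values [u n t] are only close to [A], so compactness is applied to nearby points of [A]. *)
  have /choice[p pP] : forall n, exists p, A p /\ `|u n t - p| <= c n.
    by move=> n; have [p ? ?] := uA n t tT; exists p.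
  have [l Al pl] := ultra_limit UU cA (fun n => (pP n).1).
  exists l => _; split => //; apply/cvgrPdist_le => r r0.
  have r2 : 0 < r / 2 by rewrite divr_gt0.
  move/cvgrPdist_le : (pl) => /(_ _ r2); move/cvgrPdist_le : (cU) => /(_ _ r2).
  apply: filterS2 => n; rewrite sub0r normrN => cn ln.
  rewrite -(subrKA (p n)) (le_trans (ler_normD _ _))// (splitr r) lerD//.
  by rewrite distrC (le_trans (pP n).2)// (le_trans (ler_norm _) cn).
have x_lip s t : 0 <= s <= T -> 0 <= t <= T -> `|x t - x s| <= M * `|t - s|.
  move=> sT tT; have /(_ tT)[_ xt] := xP t; have /(_ sT)[_ xs] := xP s.
  have uts : `|u n t - u n s| @[n --> U] --> `|x t - x s|.
    by apply: cvg_norm; apply: cvgB.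
  by apply: (cvgr_to_le uts); apply: nearW => n; exact: u_lip.
have unif r : 0 < r -> \forall n \near U, forall t, 0 <= t <= T ->
    `|u n t - x t| <= r.
  move=> r0; have r3 : 0 < r / 3 by rewrite divr_gt0.
  (* The mesh is so fine that an [M]-Lipschitz function varies by at most [r / 3] within a cell.
     Uniformity then reduces to finitely many nodes, and a filter is stable under finite
     intersections. *)
  pose N := (Num.truncn (M * T / (r / 3))).+1.
  have N0 : (0 < N)%N by [].
  have MN : M * step T N <= r / 3.
    rewrite mulrA ler_pdivrMr ?ltr0n// [leRHS]mulrC -ler_pdivrMr//.
    exact/ltW/truncnS_gt.
  have grid k : (k <= N.+1)%N -> \forall n \near U, forall i, (i < k)%N ->
      `|u n (node T N i) - x (node T N i)| <= r / 3.
    elim: k => [|k ih] kN; first exact: nearW.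
    have kT : 0 <= node T N k <= T by rewrite node_ge0// node_leT.
    have /(_ kT)[_ /cvgrPdist_le/(_ _ r3)] := xP (node T N k).
    have := ih (ltnW kN); apply: filterS2 => n ih' hk i.
    rewrite ltnS leq_eqVlt => /predU1P[->|]; last exact: ih'.
    by rewrite distrC.
  have := grid N.+1 (leqnn _); apply: filterS => n hn t tT.
  have [i iN ti] : exists2 i, (i < N.+1)%N & `|t - node T N i| <= step T N.
    have /andP[t0 tT'] := tT; move: t0; rewrite le_eqVlt => /predU1P[<-|t0].
      by exists 0%N => //; rewrite node0 subrr normr0 ltW// step_gt0.
    have [|k kN /andP[kt tk]] := @node_cell R T N N0 t; first by rewrite t0.
    exists k; first exact: ltnW.
    by rewrite ger0_norm ?subr_ge0 ?(ltW kt)// lerBlDl -nodeS.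
  have iT : 0 <= node T N i <= T by rewrite node_ge0// node_leT.
  have h1 : `|u n t - u n (node T N i)| <= r / 3.
    by apply: le_trans (u_lip n _ _ iT tT) _; apply: le_trans MN; rewrite ler_wpM2l.
  have h2 : `|x (node T N i) - x t| <= r / 3.
    rewrite distrC; apply: le_trans (x_lip _ _ iT tT) _.
    by apply: le_trans MN; rewrite ler_wpM2l.
  rewrite -(subrKA (u n (node T N i))) (le_trans (ler_normD _ _))//.
  have := hn i iN.
  have := ler_normD (u n (node T N i) - x (node T N i)) (x (node T N i) - x t).
  by rewrite subrKA; lra.
pose B j := [set n | forall t, 0 <= t <= T -> `|u n t - x t| <= j.+1%:R^-1].
have [|phi phi_inc phiB] := @increasing_selection B.
  move=> j m; have j0 : 0 < j.+1%:R^-1 :> R by rewrite invr_gt0.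
  have : \forall n \near U, (m < n)%N by apply: oU; exact: nbhs_infty_gt.
  move=> /(filterI (unif _ j0))/filter_ex[n [hn mn]].
  by exists n.
exists phi, x; split => // [t /xP[]//|r r0].
have rN : 0 < r^-1 by rewrite invr_gt0.
exists (Num.truncn r^-1) => j t jN tT.
apply: le_trans (phiB j t tT) _.
rewrite -[leRHS]invrK lef_pV2 ?posrE// ltW//.
by apply: lt_le_trans (truncnS_gt _) _; rewrite ler_nat.
Qed.

End Compactness.

(** * Almost everywhere limits from the parallelogram law *)

Section StrongLimits.
Context {R : realType} {H : completeNormedModType R}.
Variable dot : {dot H for idfun}.
Hypothesis dotE : induces_norm dot.
Local Notation mu := (@lebesgue_measure R).
Variables (T M : R).
Hypotheses (T0 : 0 <= T) (M0 : 0 <= M).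

Lemma pmeas_bmeas_sqr_norm (g : R -> H) (B : R) : pmeas dot g ->
  (forall t, `|g t| <= B) -> bmeas (fun t => `|g t| ^+ 2).
Proof.
move=> mg gB; have := pmeas_bmeas_norm dotE mg gB => mgn.
by have := bmeasM mgn mgn.
Qed.

(** The integrals of the steps are summable, so the sum of the steps is integrable, hence finite
    almost everywhere. *)
Lemma ae_cvgn_of_L2_steps (g : nat -> R -> H) :
  (forall n, pmeas dot (g n)) -> (forall n t, `|g n t| <= M) ->
  (forall n, rint 0 T (fun t => `|g n t - g n.+1 t| ^+ 2) <= 4^-1 ^+ n) ->
  {ae mu, forall t, 0 <= t <= T -> cvgn (g ^~ t)}.
Proof.
move=> mg gM gL2.
pose k n t := `|g n t - g n.+1 t|.
have gg n t : `|g n t - g n.+1 t| <= M + M.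
  by rewrite (le_trans (ler_normB _ _))// lerD.
have mgg n : pmeas dot (fun t => g n t - g n.+1 t) by apply: pmeasB.
have k_ge0 n t : 0 <= k n t by exact: normr_ge0.
have mk n : bmeas (k n) by exact: pmeas_bmeas_norm (gg n).
have mk2 n : bmeas (fun t => k n t ^+ 2) by exact: pmeas_bmeas_sqr_norm (gg n).
have k_le n : rint 0 T (k n) <= (1 + T) / 2 * 2^-1 ^+ n.
  (* Weights with [a * b = 1] in [k <= (a * k ^+ 2 + b) / 2], balanced so that a bound [4^-1 ^+ n]
     on the integral of the square gives one of order [2^-1 ^+ n] on the integral itself. *)
  pose a : R := 2 ^+ n; pose b : R := 2^-1 ^+ n.
  have ab : a * b = 1 by rewrite /a /b -exprMn divff// expr1n.
  have a0 : 0 < a by rewrite exprn_gt0.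
  have b0 : 0 < b by rewrite exprn_gt0// invr_gt0.
  apply: (@le_trans _ _ (rint 0 T (fun t => a / 2 * k n t ^+ 2 + b / 2))).
    apply: rint_le => //.
      by apply: bmeasD; [exact: bmeasZ|exact: bmeas_cst].
    move=> t _; have : 0 <= b * (a * k n t - 1) ^+ 2 by rewrite mulr_ge0 ?sqr_ge0 ?ltW.
    have -> : b * (a * k n t - 1) ^+ 2 =
      (a * b) * a * k n t ^+ 2 - 2 * (a * b) * k n t + b by ring.
    by rewrite ab; lra.
  rewrite rintD; [|exact: bmeasZ|exact: bmeas_cst].
  rewrite rintZ// rint_cst// subr0.
  have : a / 2 * rint 0 T (fun t => k n t ^+ 2) <= a / 2 * 4^-1 ^+ n.
    by apply: ler_wpM2l; [rewrite divr_ge0// ltW|exact: gL2].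
  have -> : 4^-1 ^+ n = b * b :> R.
    by rewrite /b -exprMn -invfM -natrM.
  have -> : a / 2 * (b * b) = (a * b) * b / 2 by ring.
  by rewrite ab -/b; lra.
have sum_fin : (\int[mu]_(t in `[0%R, T]) (\sum_(n <oo) (k n t)%:E) < +oo)%E.
  rewrite integral_nneseries//; last 2 first.
  - by move=> n; apply/measurable_EFinP; exact: measurable_funS (mk n).1.
  - by move=> n t _; rewrite lee_fin k_ge0.
  apply: (@le_lt_trans _ _ (\sum_(n <oo) ((1 + T) / 2 * 2^-1 ^+ n)%:E)%E).
    apply: lee_nneseries => [n _ _|n _]; rewrite rint_EFin// lee_fin//.
    exact: rint_ge0.
  have cg : cvgn (series (geometric ((1 + T) / 2) (2^-1 : R))).
    by apply: is_cvg_geometric_series; rewrite ger0_norm//; lra.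
  rewrite (_ : (fun _ => _) =
      EFin \o series (geometric ((1 + T) / 2) (2^-1 : R))).
    by rewrite EFin_lim// ltry.
  by apply/funext => n; rewrite /= seriesEnat/= sumEFin.
have : mu.-integrable `[0%R, T] (fun t => \sum_(n <oo) (k n t)%:E)%E.
  apply/integrableP; split.
    apply: ge0_emeasurable_sum => [n t _ _|n _]; first by rewrite lee_fin k_ge0.
    by apply/measurable_EFinP; exact: measurable_funS (mk n).1.
  apply: le_lt_trans sum_fin; rewrite le_eqVlt; apply/orP; left; apply/eqP.
  apply: eq_integral => t _.
  by rewrite gee0_abs//; apply: nneseries_ge0 => n _ _; rewrite lee_fin k_ge0.
move=> sum_int; have /(_ (measurable_itv _)) := fun mI => integrable_ae mI sum_int.
apply: filterS => t + tT.
rewrite /= in_itv/= => /(_ tT) kfin.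
apply: cvgn_of_summable_steps; apply: nondecreasing_is_cvgn.
  by apply: nondecreasing_series => n _ _.
exists (fine (\sum_(n <oo) (k n t)%:E)%E) => _ [n _ <-].
rewrite -lee_fin fineK// seriesEnat/= -sumEFin.
by apply: nneseries_lim_ge => i _; rewrite lee_fin k_ge0.
Qed.

Lemma pmeas_ae_limit (g : nat -> R -> H) :
  (forall n, pmeas dot (g n)) -> (forall n t, `|g n t| <= M) ->
  {ae mu, forall t, 0 <= t <= T -> cvgn (g ^~ t)} ->
  exists l, [/\ pmeas dot l, forall t, `|l t| <= M &
    {ae mu, forall t, 0 <= t <= T -> g n t @[n --> \oo] --> l t}].
Proof.
move=> mg gM [N [mN N0 subN]].
pose A := `[0, T]%classic `\` N.
have mA : measurable A by apply: measurableD.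
have AP t : A t -> cvgn (g ^~ t).
  move=> [tT tN]; apply: contrapT => ht; apply: tN; apply: subN => /=.
  by apply: contra_not ht; apply; move: tT; rewrite /= in_itv.
pose l t := limn (fun n => \1_A t *: g n t).
have cl t : (\1_A t *: g n t) @[n --> \oo] --> l t.
  rewrite /l indicE; have [tA|tA] := boolP (t \in A); last first.
    by under eq_fun do rewrite scale0r; exact: is_cvg_cst.
  by under eq_fun do rewrite scale1r; apply: AP; exact: set_mem.
exists l; split.
- apply: (@pmeas_cvg _ _ _ dotE (fun n t => \1_A t *: g n t)) => // n.
  exact: pmeas_indic.
- move=> t; apply: (cvgr_to_le (cvg_norm (cl t))); apply: nearW => n.
  by rewrite indicE; case: (t \in A); rewrite ?scale1r ?scale0r ?normr0.
- exists N; split => // t /= ht; apply: contrapT => tN; apply: ht => tT.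
  have := cl t; rewrite indicE mem_set; last by split => //=; rewrite in_itv.
  by under eq_fun do rewrite scale1r.
Qed.

(* Midpoints of the tail [w_ n, n >= m] are all that the parallelogram law needs;
   general convex combinations are avoided. *)
Definition midpoint_hull (w_ : nat -> (R -> H) * (R -> H)) (m : nat) :
    set ((R -> H) * (R -> H)) :=
  [set w | forall Q : set ((R -> H) * (R -> H)),
    (forall n, (m <= n)%N -> Q (w_ n)) ->
    (forall u v, Q u -> Q v -> Q (2^-1 *: (u + v))) -> Q w].

(** The sum [J] of the squared [L^2] norms of the two components satisfies the integrated
    parallelogram identity, so [midpoint_minimizing] applies with [J] in both roles. Measurability
    and bounds reach the hull by instantiating its defining quantifier with them. *)
Lemma midpoint_hull_L2_cauchy (w_ : nat -> (R -> H) * (R -> H)) :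
  (forall n, pmeas dot (w_ n).1 /\ pmeas dot (w_ n).2) ->
  (forall n t, `|(w_ n).1 t| <= M /\ `|(w_ n).2 t| <= M) ->
  exists w : nat -> (R -> H) * (R -> H), [/\
    forall n, midpoint_hull w_ n (w n),
    forall n, pmeas dot (w n).1 /\ pmeas dot (w n).2,
    forall n t, `|(w n).1 t| <= M /\ `|(w n).2 t| <= M &
    forall n,
      rint 0 T (fun t => `|(w n).1 t - (w n.+1).1 t| ^+ 2) <= 4^-1 ^+ n /\
      rint 0 T (fun t => `|(w n).2 t - (w n.+1).2 t| ^+ 2) <= 4^-1 ^+ n].
Proof.
move=> mw wM.
pose S := midpoint_hull w_.
have S_dec : {homo S : m n / (m <= n)%N >-> n `<=` m}.
  by move=> m n mn w Sw Q Qw Qm; apply: Sw => // i /(leq_trans mn); exact: Qw.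
have S_mid n u v : S n u -> S n v -> S n (2^-1 *: (u + v)).
  by move=> Su Sv Q Qw Qm; apply: (Qm); [exact: (Su Q)|exact: (Sv Q)].
have Smeas n w : S n w -> pmeas dot w.1 /\ pmeas dot w.2.
  move=> Sw; apply: (Sw (fun w => pmeas dot w.1 /\ pmeas dot w.2)) =>
    [i _|u v [mu1 mu2] [mv1 mv2]]; first exact: mw.
  by split; apply: pmeasZ; exact: pmeasD.
have SM n w : S n w -> forall t, `|w.1 t| <= M /\ `|w.2 t| <= M.
  move=> Sw; apply: (Sw (fun w => forall t, `|w.1 t| <= M /\ `|w.2 t| <= M)) =>
    [i _|u v uM vM t]; first exact: wM.
  have [u1 u2] := uM t; have [v1 v2] := vM t.
  have half (a b : H) : `|a| <= M -> `|b| <= M -> `|2^-1 *: (a + b)| <= M.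
    move=> aM bM; rewrite normrZ ger0_norm//.
    by have := ler_normD a b; lra.
  by split; exact: half.
pose J (w : (R -> H) * (R -> H)) :=
  rint 0 T (fun t => `|w.1 t| ^+ 2) + rint 0 T (fun t => `|w.2 t| ^+ 2).
have rint_sqr_ge0 (g : R -> H) : 0 <= rint 0 T (fun t => `|g t| ^+ 2).
  by apply: rint_ge0 => t; exact: sqr_ge0.
have par (g g' : R -> H) : pmeas dot g -> pmeas dot g' ->
    (forall t, `|g t| <= M) -> (forall t, `|g' t| <= M) ->
    rint 0 T (fun t => `|2^-1 *: (g t + g' t)| ^+ 2) +
    rint 0 T (fun t => `|g t - g' t| ^+ 2) / 4 =
    (rint 0 T (fun t => `|g t| ^+ 2) + rint 0 T (fun t => `|g' t| ^+ 2)) / 2.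
  move=> mg mg' gM g'M.
  have b1 := pmeas_bmeas_sqr_norm mg gM.
  have b2 := pmeas_bmeas_sqr_norm mg' g'M.
  have b3 : bmeas (fun t => `|2^-1 *: (g t + g' t)| ^+ 2).
    apply: (@pmeas_bmeas_sqr_norm _ (2^-1 * (M + M))); first exact/pmeasZ/pmeasD.
    move=> t; rewrite normrZ ger0_norm// ler_wpM2l//.
    by rewrite (le_trans (ler_normD _ _))// lerD.
  have b4 : bmeas (fun t => `|g t - g' t| ^+ 2).
    apply: (@pmeas_bmeas_sqr_norm _ (M + M)); first exact: pmeasB.
    by move=> t; rewrite (le_trans (ler_normB _ _))// lerD.
  rewrite mulrC -rintZ// -rintD//; last exact: bmeasZ.
  rewrite [RHS]mulrC -rintD// -rintZ//; last exact: bmeasD.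
  congr rint; apply/funext => t.
  by rewrite [RHS]mulrC -(parallelogram dotE) mulrC.
have d0 n : 0 < 4^-1 ^+ n :> R by rewrite exprn_gt0.
have [||||w [Sw [Qw _]]] := @midpoint_minimizing R _ S J J (2 * (T * M ^+ 2))
  (fun n => 4^-1 ^+ n) d0 _ _ S_dec S_mid.
- by move=> m n mn; apply: ler_wiXn2l => //; lra.
- by move=> n; exists (w_ n) => Q Qw _; exact: Qw.
- move=> u Su; rewrite addr_ge0//=.
  have [mu1 mu2] := Smeas _ _ Su; have uM := SM _ _ Su.
  have bd (g : R -> H) : pmeas dot g -> (forall t, `|g t| <= M) ->
      rint 0 T (fun t => `|g t| ^+ 2) <= T * M ^+ 2.
    move=> mg gM; rewrite -[T in T * _]subr0 -rint_cst//; apply: rint_le.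
    - exact: pmeas_bmeas_sqr_norm gM.
    - exact: bmeas_cst.
    by move=> t _; rewrite ler_pXn2r// nnegrE.
  have := bd _ mu1 (fun t => (uM t).1); have := bd _ mu2 (fun t => (uM t).2).
  by rewrite /J; lra.
- move=> u v Su Sv; have [mu1 mu2] := Smeas _ _ Su; have uM := SM _ _ Su.
  have [mv1 mv2] := Smeas _ _ Sv; have vM := SM _ _ Sv.
  have := par _ _ mu1 mv1 (fun t => (uM t).1) (fun t => (vM t).1).
  have := par _ _ mu2 mv2 (fun t => (uM t).2) (fun t => (vM t).2).
  rewrite /J /=; lra.
exists w; split => //.
- by move=> n; exact: Smeas (Sw n).
- by move=> n; exact: SM (Sw n).
move=> n; have := Qw n; rewrite /J /=.
have := rint_sqr_ge0 (fun t => (w n).1 t - (w n.+1).1 t).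
have := rint_sqr_ge0 (fun t => (w n).2 t - (w n.+1).2 t).
by move=> ? ? ?; split; lra.
Qed.

End StrongLimits.

(** * Identification of the limits *)

Lemma midpoint_dist_le (R : realFieldType) (a b c r : R) :
  `|a - c| <= r -> `|b - c| <= r -> `|2^-1 * (a + b) - c| <= r.
Proof.
rewrite !ler_norml => /andP[? ?] /andP[? ?]; apply/andP; split; lra.
Qed.

Lemma midpoint_le (R : realFieldType) (a b c : R) :
  a <= c -> b <= c -> 2^-1 * (a + b) <= c.
Proof. lra. Qed.

Section PointwiseLimits.
Context {R : realType} {H : completeNormedModType R}.
Variable dot : {dot H for idfun}.
Hypothesis dotE : induces_norm dot.
Implicit Types (C : set H) (l e : H).

(** The point [q + (m * s) *: b] competes in the projection of [w]. Expanding the squares and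
    dividing by [m ^+ 2 * s] leaves [2 * dot a b < s * (|b| ^+ 2 + 1)], the [1] being the share of
    [e]. *)
Lemma approx_proj_test C (w q a b : H) (m s e : R) :
  w - q = m *: a -> 0 < m -> 0 < s -> e = m ^+ 2 * s ^+ 2 ->
  approx_proj e C w q -> C (q + (m * s) *: b) ->
  dot a b <= s * ((`|b| ^+ 2 + 1) / 2).
Proof.
move=> wqE m0 s0 eE [_]; rewrite wqE eE => lt_wq Cb.
have : dist_to C w ^+ 2 <= `|m *: a - (m * s) *: b| ^+ 2.
  rewrite ler_pXn2r// ?nnegrE ?dist_to_ge0//.
  by have := dist_to_le w Cb; rewrite opprD addrA wqE.
rewrite -scalerA -scalerBr; move: lt_wq; rewrite !normrZ !exprMn (gtr0_norm m0).
rewrite (sqr_normB dotE a) (dotZr dot s) normrZ exprMn (gtr0_norm s0).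
have m2 : 0 < m ^+ 2 by rewrite exprn_gt0.
move=> h1 h2.
have : m ^+ 2 * (2 * (s * dot a b)) < m ^+ 2 * (s * (s * (`|b| ^+ 2 + 1))).
  by lra.
by rewrite ltr_pM2l// mulrCA ltr_pM2l// => /ltW; lra.
Qed.

(* [q n] is tested against the point [q n + (m n * s n) *: v' n] of [C], where
   [v' n --> v] comes from the tangency of [v] and [s n] is chosen so that the
   error [e n / m n ^ 2] is of the order of [s n ^ 2]. *)
Lemma approx_proj_normal_limit C l (v : H) (q w : nat -> H) (m e : nat -> R) (M r : R) :
  clarke_tangent C l v -> (forall n, approx_proj (e n) C (w n) (q n)) ->
  q n @[n --> \oo] --> l -> (forall n, 0 < m n) -> m n @[n --> \oo] --> 0 ->
  (forall n, 0 < e n) -> e n / m n ^+ 2 @[n --> \oo] --> 0 ->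
  (forall n, `|(m n)^-1 *: (w n - q n)| <= M) -> 0 < r ->
  \forall n \near \oo, dot ((m n)^-1 *: (w n - q n)) v <= r.
Proof.
move=> Tv wq ql m0 ml e0 el nuM r0.
pose s n := Num.sqrt (e n / m n ^+ 2).
have em0 n : 0 < e n / m n ^+ 2 by rewrite divr_gt0// exprn_gt0.
have s0 n : 0 < s n by rewrite sqrtr_gt0.
have sl : s n @[n --> \oo] --> 0.
  by rewrite -[0](@sqrtr0 R); apply: cvg_comp el _; exact: sqrt_continuous.
have tl : m n * s n @[n --> \oo] --> 0 by rewrite -[0](mul0r 0); exact: cvgM.
have [v' [v'v v'C]] := Tv q (fun n => m n * s n) (fun n => (wq n).1) ql
  (fun n => mulr_gt0 (m0 n) (s0 n)) tl.
have nu_le n : dot ((m n)^-1 *: (w n - q n)) (v' n) <=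
    s n * ((`|v' n| ^+ 2 + 1) / 2).
  apply: (approx_proj_test (m := m n) _ _ _ _ (wq n) (v'C n)) => //.
    by rewrite scalerA divff ?gt_eqF// scale1r.
  by rewrite /s sqr_sqrtr ?(ltW (em0 n))// mulrC divfK// expf_neq0// gt_eqF.
(* The second term pays for testing with the fixed [v] instead of [v' n]. *)
have bnd_cvg : s n * ((`|v' n| ^+ 2 + 1) / 2) + M * `|v - v' n| @[n --> \oo] --> 0.
  rewrite -[0](addr0 0) -[X in X + _](mul0r ((`|v| ^+ 2 + 1) / 2)).
  rewrite -[X in _ + X](mulr0 M) -[X in M * X](normr0 H) -(subrr v).
  apply: cvgD.
    apply: cvgM => //; apply: cvgM; last exact: cvg_cst.
    apply: cvgD; last exact: cvg_cst.
    by rewrite expr2; under eq_fun do rewrite expr2; apply: cvgM; exact: cvg_norm.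
  by apply: cvgM; [exact: cvg_cst|apply: cvg_norm; apply: cvgB => //; exact: cvg_cst].
have : \forall n \near \oo, s n * ((`|v' n| ^+ 2 + 1) / 2) + M * `|v - v' n| < r.
  exact: cvgr_lt bnd_cvg _ r0.
apply: filterS => n /ltW; apply: le_trans.
have := nu_le n; have := nuM n; move: (_ *: _) => a aM av'.
have -> : dot a v = dot a (v' n) + dot a (v - v' n).
  by rewrite (dotBr dot a v) addrC subrK.
rewrite lerD//.
by apply: le_trans (dot_le dotE _ _) _; rewrite ler_wpM2r.
Qed.

Lemma dot_weak_continuous e : continuous (dot e : @weak_topology R H -> R).
Proof.
move=> y; pose l : cdual := exist _ (dot e : {scalar H}) (@dot_continuous _ _ dot dotE e).
have /cvg_sup/(_ l) yl : nbhs (y : @weak_topology R H) --> (y : @weak_topology R H).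
  by [].
exact: cvg_trans (cvg_app (dot e) yl) (@initial_continuous _ _ (sval l) y).
Qed.

Lemma weakly_closed_halfspace e (c : R) : weakly_closed [set w | c <= dot e w].
Proof.
rewrite /weakly_closed.
apply: (@closed_comp (@weak_topology R H) R (dot e) [set s | c <= s]).
  by move=> y _; exact: dot_weak_continuous.
exact: closed_ge.
Qed.

(** The last hypothesis places [l] in every closed half-space containing a tail of [z], a property
    shared by limits of midpoint combinations of tails. The points whose image meets [c <= dot e _]
    form a closed set missing [y], so [dot e (z n) < c] eventually, against [c < dot e l]. *)
Lemma usc_into_weak_limit (G : H -> set H) (y l : H) (p z : nat -> H) :
  usc_into_weak G -> G y !=set0 -> closed (G y) -> convex_set (G y) ->
  p n @[n --> \oo] --> y -> (forall n, G (p n) (z n)) ->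
  (forall e c, (\forall n \near \oo, dot e (z n) <= c) -> dot e l <= c) -> G y l.
Proof.
move=> uG G0 Gcl Gcv py Gz zl; apply: contrapT => Gl.
have [e [c [Gc cl]]] := separation dotE G0 Gcl Gcv Gl.
have := uG _ (@weakly_closed_halfspace e c); set D := [set x | _] => Dcl.
have nDy : (~` D) y by move=> [a [/Gc /lt_le_trans h /h]]; rewrite ltxx.
have : dot e l <= c.
  apply: zl; have : \forall n \near \oo, (~` D) (p n).
    by apply: py; apply: open_nbhs_nbhs; split => //; exact: closed_openC.
  apply: filterS => n nD; rewrite leNgt; apply/negP => cz; apply: nD.
  by exists (z n); split => //; exact: ltW.
by rewrite leNgt cl.
Qed.

(** The hull at [n] combines only terms of index at least [n], so a threshold for the sequence is
    one for its combinations. With [Q] a linear inequality at a fixed time, this carries pointwise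
    information to the limits. *)
Lemma midpoint_hull_near (w_ w : nat -> (R -> H) * (R -> H))
    (Q : set ((R -> H) * (R -> H))) :
  (forall n, midpoint_hull w_ n (w n)) ->
  (forall u v, Q u -> Q v -> Q (2^-1 *: (u + v))) ->
  (\forall n \near \oo, Q (w_ n)) -> \forall n \near \oo, Q (w n).
Proof.
move=> ww Qm [N _ QN]; exists N => // n /= Nn.
by apply: ww => // j nj; apply: QN; exact: leq_trans nj.
Qed.

End PointwiseLimits.

Theorem theorem4 (R : realType) (H : completeNormedModType R)
    (dot : {dot H for idfun}) (dotE : induces_norm dot)
    (T : R) (T_gt0 : 0 < T)
    (C : set H) (C_neq0 : C !=set0) (C_bc : ball_compact C)
    (F : R -> H -> set H)
    (F_val : forall (t : R) (x : H), t \in `[0, T] ->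
       [/\ F t x !=set0, closed (F t x) & convex_set (F t x)])
    (H1 : forall t : R, t \in `[0, T] -> usc_into_weak (F t))
    (h : H -> R) (Lh : R) (Lh_gt0 : 0 < Lh)
    (h_ge0 : forall x, 0 <= h x) (h_lip : Lh.-lipschitz h)
    (H2 : forall x : H, {ae @lebesgue_measure R, forall t : R, t \in `[0, T] ->
       inf [set `|w| | w in F t x] <= h x})
    (gamma : R) (gamma_gt0 : 0 < gamma)
    (f : R -> H -> H)
    (H3_proj : forall (t : R) (x : H), t \in `[0, T] -> approx_proj gamma (F t x) 0 (f t x))
    (H3_meas : forall x, strongly_measurable 0 T (fun t => f t x))
    (x0 : H) (x0C : C x0)
    (eps : nat -> R) (eps_gt0 : forall n, (0 < n)%N -> 0 < eps n)
    (eps_cvg : eps n / step T n ^+ 2 @[n --> \oo] --> 0)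
    (x_ : nat -> R -> H) (x_cu : catching_up C f T x0 eps x_) :
  exists (phi : nat -> nat) (x : R -> H),
    [/\ increasing_seq phi,
        {uniform `[0, T], x_ (phi j) @[j --> \oo] --> x},
        [lipschitz x t | t in `[0, T]] &
        [/\ {ae @lebesgue_measure R, forall t : R, t \in `[0, T] ->
               derivable x t 1 /\
               [set - w + z | w in clarke_normal dot C (x t) & z in F t (x t)]
                 ('D_1 x t)},
            x 0 = x0 &
            {ae @lebesgue_measure R, forall t : R, t \in `[0, T] ->
               `|'D_1 x t| <= 2 * (h (x t) + Num.sqrt gamma)}]].
Proof.
have h_lip' p q : `|h p - h q| <= Lh * `|p - q|.
  by have := h_lip (p, q) (conj I I).
have sg0 : 0 <= Num.sqrt gamma by exact: sqrtr_ge0.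
have hg p : 0 <= h p + Num.sqrt gamma by rewrite addr_ge0.
(* By (H3), [|f t p| ^+ 2] is below the squared infimum plus [gamma], which by (H2) is at most
   [(h p + sqrt gamma) ^+ 2]. *)
have f_le p : {ae @lebesgue_measure R, forall t, t \in `[0, T] -> `|f t p| <= h p + Num.sqrt gamma}.
  apply: filterS (H2 p) => t + tT => /(_ tT) hp.
  have [_] := H3_proj t p tT; rewrite sub0r normrN.
  have -> : dist_to (F t p) 0 = inf [set `|w| | w in F t p].
    congr inf; apply: eq_imagel => w _; by rewrite sub0r normrN.
  have inf0' : 0 <= inf [set `|w| | w in F t p].
    have [[w Fw] _ _] := F_val t p tT; apply: lb_le_inf; first by exists `|w|, w.
    by move=> _ [? _ <-].
  move=> /ltW hf; rewrite -(@ler_pXn2r _ 2)// ?nnegrE//; apply: (le_trans hf).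
  rewrite sqrrD sqr_sqrtr ?(ltW gamma_gt0)// -addrA lerD//.
    by rewrite ler_pXn2r ?nnegrE.
  by rewrite lerDr mulrn_wge0// mulr_ge0.
have /choice[ft ftP] : forall p, exists g, [/\ pmeas dot g,
    forall t, `|g t| <= h p + Num.sqrt gamma &
    {ae @lebesgue_measure R, forall t, 0 <= t <= T -> g t = f t p}].
  by move=> p; exact: (strongly_measurable_pmeas dotE (hg p) (H3_meas p) (f_le p)).
pose rho := T * (2 * (h x0 + Num.sqrt gamma) + 1) * expR (T * (2 * Lh)).
pose K := h x0 + Lh * rho + Num.sqrt gamma.
have rho0 : 0 <= rho by exact: scheme_rho_ge0.
have K0 : 0 <= K by rewrite /K !addr_ge0// mulr_ge0// ltW.
have K21 : 0 <= 2 * K + 1 by rewrite addr_ge0// mulr_ge0.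
(* From [N0] on, [eps n / step T n ^+ 2] is below 1, which is what [scheme_estimates] asks. Shifting
   by [N0] also avoids the index [0], where the scheme imposes nothing. *)
have [N0 N0_gt0 epsN0] : exists2 N0, (0 < N0)%N & forall n, (N0 <= n)%N ->
    Num.sqrt (eps n) <= step T n.
  have /cvgr_lt/(_ 1 ltr01)[N _ epsN] := eps_cvg.
  exists (maxn N 1); first by rewrite leq_max orbT.
  move=> n; rewrite geq_max => /andP[/epsN /= eN n0].
  have m0 : 0 < step T n by exact: step_gt0.
  rewrite -(@ler_pXn2r _ 2)// ?nnegrE ?sqrtr_ge0 ?(ltW m0)//.
  rewrite sqr_sqrtr ?(ltW (eps_gt0 n n0))//.
  by move: eN; rewrite ltr_pdivrMr ?exprn_gt0// mul1r => /ltW.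
have idx_gt0 n : (0 < n + N0)%N by rewrite addn_gt0 N0_gt0 orbT.
have /choice[VP VPP] : forall n, exists VP : (R -> H) * (R -> H),
  [/\ pmeas dot VP.1 /\ pmeas dot VP.2,
      forall t, `|VP.1 t| <= K + 1 /\ `|VP.2 t| <= K,
      forall d t, 0 <= t <= T -> dot d (x_ (n + N0)%N t - x0) =
        rint 0 t (fun s => dot d (VP.2 s - VP.1 s)),
      forall t, 0 <= t <= T -> exists p, [/\ C p, `|p - x0| <= rho &
        `|x_ (n + N0)%N t - p| <= (2 * K + 1) * step T (n + N0)] &
      {ae @lebesgue_measure R, forall t, 0 < t <= T -> exists p q w,
        [/\ `|x_ (n + N0)%N t - p| <= (2 * K + 1) * step T (n + N0),
            `|x_ (n + N0)%N t - q| <= (2 * K + 1) * step T (n + N0),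
            approx_proj (eps (n + N0)%N) C w q,
            VP.1 t = (step T (n + N0))^-1 *: (w - q) /\ VP.2 t = f t p &
            `|VP.1 t| <= h p + Num.sqrt gamma +
              Num.sqrt (eps (n + N0)%N) / step T (n + N0) /\
            `|VP.2 t| <= h p + Num.sqrt gamma]}].
  move=> n; have [y [yC yu]] := x_cu _ (idx_gt0 n).
  have [V [P ?]] := scheme_estimates dotE T_gt0 (ltW Lh_gt0) h_ge0 h_lip' H3_meas
    (fun p => let: And3 m _ _ := ftP p in m) (fun p => let: And3 _ b _ := ftP p in b)
    (fun p => let: And3 _ _ e := ftP p in e) x0C (idx_gt0 n)
    (eps_gt0 _ (idx_gt0 n)) (epsN0 _ (leq_addl n N0)) yC yu.
  by exists (V, P).
have VPB n r : `|(VP n).2 r - (VP n).1 r| <= 2 * K + 1.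
  have [_ /(_ r)[? ?] _ _ _] := VPP n; apply: le_trans (ler_normB _ _) _.
  by rewrite (_ : 2 * K + 1 = K + (K + 1)) ?lerD//; ring.
have x_lip n s t : 0 <= s <= T -> 0 <= t <= T ->
    `|x_ (n + N0)%N t - x_ (n + N0)%N s| <= (2 * K + 1) * `|t - s|.
  have [[mV mP] _ xE _ _] := VPP n.
  exact: (primitive_lipschitz dotE K21 (pmeasB mP mV) (VPB n) xE).
have step0 : step T n @[n --> \oo] --> 0.
  rewrite -[0](mulr0 T); apply: cvgM; first exact: cvg_cst.
  rewrite -(cvg_shiftS _ _); exact: cvg_harmonic.
have shift_cvg (a : nat -> R) (l : R) : a n @[n --> \oo] --> l ->
    a (n + N0)%N @[n --> \oo] --> l by rewrite cvg_shiftn.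
(* The nodes are within [rho] of [x0]; the extra [1] makes the radius positive, as [ball_compact]
   asks. *)
pose A := C `&` [set p | `|p| <= rho + `|x0| + 1].
have cA : compact A by apply: C_bc; rewrite ltr_wpDl// addr_ge0.
have [||phi [x [phi_inc xA phi_unif]]] := @equilipschitz_subsequence R H
    (fun n => x_ (n + N0)%N) A T (2 * K + 1)
    (fun n => (2 * K + 1) * step T (n + N0)) T_gt0 cA x_lip.
- move=> n t tT; have [_ _ _ /(_ t tT)[p [Cp px up]] _] := VPP n.
  exists p => //; split => //=.
  have := ler_normD (p - x0) x0; rewrite subrK; lra.
- rewrite -[0](mulr0 (2 * K + 1)); apply: cvgM; first exact: cvg_cst.
  exact: shift_cvg.
have phi_ge j : (j <= phi j)%N.
  elim: j => // j ih; apply: (leq_ltn_trans ih).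
  by rewrite ltnNge -leEnat phi_inc ltnn.
have phi_cvg (a : nat -> R) (l : R) : a n @[n --> \oo] --> l ->
    a (phi j + N0)%N @[j --> \oo] --> l.
  move=> /shift_cvg al; apply: cvg_comp al => B [N _ NB].
  by exists N => // j /= Nj; apply: NB => /=; exact: leq_trans (phi_ge j).
have mVP j : pmeas dot (VP (phi j)).1 /\ pmeas dot (VP (phi j)).2.
  by have [] := VPP (phi j).
have VPM j t : `|(VP (phi j)).1 t| <= K + 1 /\ `|(VP (phi j)).2 t| <= K + 1.
  have [_ /(_ t)[? PK] _ _ _] := VPP (phi j).
  by split => //; rewrite (le_trans PK)// lerDl.
have [w [w_hull mw wM wL2]] := midpoint_hull_L2_cauchy dotE (ltW T_gt0)
  (addr_ge0 K0 ler01) mVP VPM.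
have [V [mV VK Vlim]] := pmeas_ae_limit dotE (addr_ge0 K0 ler01) (fun n => (mw n).1)
  (fun n t => (wM n t).1)
  (ae_cvgn_of_L2_steps dotE (ltW T_gt0) (fun n => (mw n).1)
    (fun n t => (wM n t).1) (fun n => (wL2 n).1)).
have [P [mP PK Plim]] := pmeas_ae_limit dotE (addr_ge0 K0 ler01) (fun n => (mw n).2)
  (fun n t => (wM n t).2)
  (ae_cvgn_of_L2_steps dotE (ltW T_gt0) (fun n => (mw n).2)
    (fun n t => (wM n t).2) (fun n => (wL2 n).2)).
have VPlim : {ae @lebesgue_measure R, forall t, 0 <= t <= T ->
    (w n).1 t @[n --> \oo] --> V t /\ (w n).2 t @[n --> \oo] --> P t}.
  by apply: filterS2 Vlim Plim => t + + tT => /(_ tT) ? /(_ tT).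
have mPV := pmeasB mP mV.
pose M := (K + 1) + (K + 1).
have M0 : 0 <= M := addr_ge0 (addr_ge0 K0 ler01) (addr_ge0 K0 ler01).
have PVM t : `|P t - V t| <= M by rewrite (le_trans (ler_normB _ _))// lerD.
have wPVM n t : `|(w n).2 t - (w n).1 t| <= M.
  by have [? ?] := wM n t; rewrite (le_trans (ler_normB _ _))// lerD.
have xE d t : 0 <= t <= T ->
    dot d (x t - x0) = rint 0 t (fun s => dot d (P s - V s)).
  move=> tT; have /andP[t0 t_le] := tT.
  have bw n : bmeas (fun s => dot d ((w n).2 s - (w n).1 s)).
    by apply: (pmeas_bmeas_dot dotE d _ (wPVM n)); apply: pmeasB; have [] := mw n.
  have bPV : bmeas (fun s => dot d (P s - V s)) by exact: pmeas_bmeas_dot PVM.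
  have lim_w : rint 0 t (fun s => dot d ((w n).2 s - (w n).1 s)) @[n --> \oo] -->
      rint 0 t (fun s => dot d (P s - V s)).
    apply: (@rint_cvg _ _ _ (`|d| * M)) => //.
      move=> n s; rewrite (le_trans (norm_dot_le dotE _ _))// ler_wpM2l//.
    apply: filterS VPlim => s + /andP[s0 st].
    have sT : 0 <= s <= T by rewrite s0 (le_trans st).
    by move=> /(_ sT)[Vs Ps]; apply: (cvg_dot dotE); apply: cvgB.
  apply: (cvg_unique _ _ lim_w) => //; apply/cvgrPdist_le => r r0.
  have d1 : 0 < `|d| + 1 by rewrite ltr_wpDl.
  have [N xN] := phi_unif _ (divr_gt0 r0 d1).
  exists N => // n /= Nn; rewrite distrC.
  (* Measurability and boundedness accompany the estimate, since additivity of [rint] at a midpoint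
     relies on them. *)
  pose Q (g : (R -> H) * (R -> H)) :=
    bmeas (fun s => dot d (g.2 s - g.1 s)) /\
    `|rint 0 t (fun s => dot d (g.2 s - g.1 s)) - dot d (x t - x0)| <= r.
  suff [] : Q (w n) by [].
  apply: (w_hull n Q) => [j nj|u v [bu uQ] [bv vQ]].
    have [[mVj mPj] _ xjE _ _] := VPP (phi j).
    split; first exact: (pmeas_bmeas_dot dotE d (pmeasB mPj mVj) (VPB (phi j))).
    rewrite -xjE// -(dotBr dot d (_ - x0)) opprB addrA subrK.
    apply: (le_trans (norm_dot_le dotE _ _)).
    apply: (@le_trans _ _ ((`|d| + 1) * (r / (`|d| + 1)))); last first.
      by rewrite mulrC divfK// gt_eqF.
    by apply: ler_pM => //; [rewrite lerDl|apply: xN => //; exact: leq_trans nj].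
  have midE s : dot d ((2^-1 *: (u + v)).2 s - (2^-1 *: (u + v)).1 s) =
      2^-1 * (dot d (u.2 s - u.1 s) + dot d (v.2 s - v.1 s)).
    rewrite -(dotDr dot d (u.2 s - u.1 s)) -(dotZr dot); congr (dot d _).
    by rewrite addrACA -opprD scalerBr.
  have mE : (fun s => dot d ((2^-1 *: (u + v)).2 s - (2^-1 *: (u + v)).1 s)) =
    (fun s => 2^-1 * (dot d (u.2 s - u.1 s) + dot d (v.2 s - v.1 s))).
    by apply/funext.
  rewrite /Q mE; split; first by apply: bmeasZ; exact: bmeasD.
  rewrite rintZ ?rintD//; last exact: bmeasD.
  exact: midpoint_dist_le.
have aeVP := ae_forall_countable (fun j : nat => (let: And5 _ _ _ _ a := VPP (phi j) in a)).
have x_at0 : x 0 = x0.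
  apply/eqP; rewrite -subr_eq0 -normr_eq0 -sqrf_eq0 dotE xE ?rint_point//.
  by rewrite lexx ltW.
have key : {ae @lebesgue_measure R, forall t, t \in `[0, T] -> [/\ derivable x t 1,
    [set - w + z | w in clarke_normal dot C (x t) & z in F t (x t)] ('D_1 x t) &
    `|'D_1 x t| <= 2 * (h (x t) + Num.sqrt gamma)]}.
  have x_deriv := primitive_derivable dotE M0 mPV PVM xE.
  (* Time [0] is discarded because it belongs to no cell. *)
  have ae_t : {ae @lebesgue_measure R, forall t, t \in `[0, T] ->
      0 < t <= T /\ (derivable x t 1 /\ 'D_1 x t = P t - V t)}.
    apply: filterS2 (lebesgue_ae_neq 0) x_deriv => t t0 xt tT; split; last exact: xt.
    by move: tT; rewrite in_itv/= => /andP[? ->]; rewrite lt_neqAle eq_sym t0 andbT.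
  apply: filterS3 ae_t VPlim aeVP => t ht VPt' VPt tT.
  have [t_gt0 [dx Dx]] := ht tT.
  have tT' : 0 <= t <= T by move: tT; rewrite in_itv.
  have [Vt Pt] := VPt' tT'.
  have /choice[pqw pqwP] : forall j, exists pqw : H * H * H,
    [/\ `|x_ (phi j + N0)%N t - pqw.1.1| <= (2 * K + 1) * step T (phi j + N0),
        `|x_ (phi j + N0)%N t - pqw.1.2| <= (2 * K + 1) * step T (phi j + N0),
        approx_proj (eps (phi j + N0)%N) C pqw.2 pqw.1.2,
        (VP (phi j)).1 t = (step T (phi j + N0))^-1 *: (pqw.2 - pqw.1.2) /\
          (VP (phi j)).2 t = f t pqw.1.1 &
        `|(VP (phi j)).1 t| <= h pqw.1.1 + Num.sqrt gamma +
          Num.sqrt (eps (phi j + N0)%N) / step T (phi j + N0) /\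
        `|(VP (phi j)).2 t| <= h pqw.1.1 + Num.sqrt gamma].
    by move=> j; have [p [q [w' ?]]] := VPt j t_gt0; exists (p, q, w').
  have near_x (p : nat -> H) : (forall j,
      `|x_ (phi j + N0)%N t - p j| <= (2 * K + 1) * step T (phi j + N0)) ->
      p j @[j --> \oo] --> x t.
    move=> pP; apply/cvgrPdist_le => r r0.
    have r2 : 0 < r / 2 by rewrite divr_gt0.
    have [N xN] := phi_unif _ r2.
    have : (2 * K + 1) * step T (phi j + N0) @[j --> \oo] --> 0.
      rewrite -[0](mulr0 (2 * K + 1)); apply: cvgM; first exact: cvg_cst.
      exact: phi_cvg.
    move=> /cvgrPdist_le/(_ _ r2); have : \forall j \near \oo, (N <= j)%N.
      by exists N.
    apply: filterS2 => j Nj; rewrite sub0r normrN => sj.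
    rewrite -(subrKA (x_ (phi j + N0)%N t)) (le_trans (ler_normD _ _))//.
    rewrite (splitr r) lerD//; first by rewrite distrC xN.
    exact: le_trans (pP j) (le_trans (ler_norm _) sj).
  have px : (pqw j).1.1 @[j --> \oo] --> x t.
    by apply: near_x => j; have [] := pqwP j.
  have qx : (pqw j).1.2 @[j --> \oo] --> x t.
    by apply: near_x => j; have [] := pqwP j.
  have wq j : approx_proj (eps (phi j + N0)%N) C (pqw j).2 (pqw j).1.2.
    by have [] := pqwP j.
  have sm0 j : 0 < step T (phi j + N0) by exact: step_gt0.
  have se : Num.sqrt (eps (phi j + N0)%N) / step T (phi j + N0) @[j --> \oo] --> 0.
    have := phi_cvg _ _ eps_cvg.
    move=> /(cvg_comp _ _) /(_ (@sqrt_continuous R 0)); rewrite sqrtr0.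
    apply: cvg_trans; apply: near_eq_cvg; apply: nearW => j /=.
    rewrite sqrtrM ?(ltW (eps_gt0 _ _))// sqrtrV ?exprn_ge0 ?(ltW (sm0 j))//.
    by rewrite sqrtr_sqr gtr0_norm.
  have hx : h (pqw j).1.1 @[j --> \oo] --> h (x t).
    apply/cvgrPdist_le => r r0; move/cvgrPdist_le : px => /(_ _ (divr_gt0 r0 Lh_gt0)).
    apply: filterS => j; rewrite ler_pdivlMr// mulrC; exact: le_trans.
  have dotV e c : (\forall j \near \oo, dot e ((VP (phi j)).1 t) <= c) ->
      dot e (V t) <= c.
    move=> Vc; have lim : dot e ((w n).1 t) @[n --> \oo] --> dot e (V t).
      exact: (cvg_dot dotE).
    apply: (cvgr_to_le lim).
    apply: (midpoint_hull_near (Q := fun g => dot e (g.1 t) <= c) w_hull) => // u v /= uc vc.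
    by rewrite (dotZr dot) (dotDr dot e (u.1 t)) midpoint_le.
  have dotP e c : (\forall j \near \oo, dot e ((VP (phi j)).2 t) <= c) ->
      dot e (P t) <= c.
    move=> Pc; have lim : dot e ((w n).2 t) @[n --> \oo] --> dot e (P t).
      exact: (cvg_dot dotE).
    apply: (cvgr_to_le lim).
    apply: (midpoint_hull_near (Q := fun g => dot e (g.2 t) <= c) w_hull) => // u v /= uc vc.
    by rewrite (dotZr dot) (dotDr dot e (u.2 t)) midpoint_le.
  (* The norm is recovered from the linear bounds [dot e _ <= c * |e|]. The slack [r] absorbs the
     convergence of [h] at the nodes and the vanishing excess [sqrt eps / step]. *)
  have normV : `|V t| <= h (x t) + Num.sqrt gamma.
    apply/ler_addgt0Pr => r r0; apply: (norm_le_dot dotE); first by rewrite addr_ge0 ?(ltW r0).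
    move=> e; apply: dotV.
    have lim : h (pqw j).1.1 + Num.sqrt gamma +
        Num.sqrt (eps (phi j + N0)%N) / step T (phi j + N0) @[j --> \oo] -->
        h (x t) + Num.sqrt gamma + 0.
      by apply: cvgD => //; apply: cvgD => //; exact: cvg_cst.
    have : h (x t) + Num.sqrt gamma + 0 < h (x t) + Num.sqrt gamma + r.
      by rewrite addr0 ltrDl.
    move=> /(cvgr_lt _ lim _); apply: filterS => j /ltW hj.
    have [_ _ _ _ [Vj _]] := pqwP j.
    apply: (le_trans (dot_le dotE _ _)); rewrite mulrC ler_wpM2r//.
    exact: le_trans hj.
  have normP : `|P t| <= h (x t) + Num.sqrt gamma.
    apply/ler_addgt0Pr => r r0; apply: (norm_le_dot dotE); first by rewrite addr_ge0 ?(ltW r0).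
    move=> e; apply: dotP.
    have lim : h (pqw j).1.1 + Num.sqrt gamma @[j --> \oo] --> h (x t) + Num.sqrt gamma.
      by apply: cvgD => //; exact: cvg_cst.
    have : h (x t) + Num.sqrt gamma < h (x t) + Num.sqrt gamma + r.
      by rewrite ltrDl.
    move=> /(cvgr_lt _ lim _); apply: filterS => j /ltW hj.
    have [_ _ _ _ [_ Pj]] := pqwP j.
    apply: (le_trans (dot_le dotE _ _)); rewrite mulrC ler_wpM2r//.
    exact: le_trans hj.
  split => //; last first.
    by rewrite Dx (le_trans (ler_normB _ _))// mulr_natl mulr2n lerD.
  rewrite Dx; exists (V t); last first.
    exists (P t); last by rewrite addrC.
    have [F0 Fcl Fcv] := F_val t (x t) tT.
    apply: (usc_into_weak_limit dotE (H1 t tT) F0 Fcl Fcv px (z := fun j => (VP (phi j)).2 t)) => //.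
    move=> j; have [_ _ _ [_ ->] _] := pqwP j.
    by have [] := H3_proj t (pqw j).1.1 tT.
  split; first by have [] := xA t tT'.
  (* Normality holds along the scheme only asymptotically: each [r > 0] eventually bounds the
     pairings with [v], and [dotV] transfers this bound to [V t]. *)
  move=> v Tv; apply/ler_addgt0Pr => r r0; rewrite add0r (dotC dot); apply: dotV.
  have nuM j : `|(step T (phi j + N0))^-1 *: ((pqw j).2 - (pqw j).1.2)| <= K + 1.
    by have [_ _ _ [<- _] _] := pqwP j; have [] := VPM j t.
  have := approx_proj_normal_limit dotE Tv wq qx sm0 (phi_cvg _ _ step0)
    (fun j => eps_gt0 _ (idx_gt0 (phi j))) (phi_cvg _ _ eps_cvg) nuM r0.
  by apply: filterS => j; have [_ _ _ [-> _] _] := pqwP j; rewrite (dotC dot v).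
exists (fun j => phi j + N0)%N, x; split.
- by move=> i j; rewrite leEnat leq_add2r -leEnat phi_inc.
- move=> B; rewrite uniform_nbhs => -[E [entE EB]].
  have [r r0 rE] : exists2 r : R, 0 < r & forall a b : H, ball a r b -> E (a, b).
    move: entE; rewrite -entourage_ballE => -[r /= r0 rE].
    by exists r => // a b abr; apply: rE.
  have r2 : 0 < r / 2 by rewrite divr_gt0.
  have [N xN] := phi_unif _ r2; exists N => // j /= Nj.
  apply: EB => t /=; rewrite in_itv/= => tT; apply: rE.
  rewrite -ball_normE /= distrC (le_lt_trans (xN j t Nj tT))//.
  by rewrite ltr_pdivrMr// ltr_pMr// ltr1n.
- apply: (@klipschitzW _ _ _ M).
    apply: (@globally_properfilter _ _ (0, 0)).
    by split; rewrite /= in_itv/= lexx ltW.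
  move=> [s t] /= [sT tT]; move: sT tT; rewrite !in_itv/= => sT tT.
  exact: (primitive_lipschitz dotE M0 mPV PVM xE tT sT).
split => //.
- by apply: filterS key => t + tT => /(_ tT)[].
- by apply: filterS key => t + tT => /(_ tT)[].
Qed.
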